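(* Let $\mathcal C$ be an admissible class of graphons, and let $H$ be a $\mathcal C$-Sidorenko graph. Put $v=v(H)$, $e=e(H)$, $s=2e-v$, and assume $s>0$. Let $W\in\mathcal C$ (on $(\Omega,\mu)$) have $p=p(W)>0$, and define $$R=R_H(W)=\frac{t(H,W)}{p(W)^e}.$$ Let $\nu$ be the probability measure on $\Omega$ given by $d\nu(x)=\frac{\deg_W(x)}{p}\,d\mu(x)$. Then $$\operatorname{Ent}(\nu\mid\mu)\le\frac{\log R}{s}.$$ Consequently, $$\|\nu-\mu\|_{\mathrm{TV}}\le\sqrt{\frac{\log R}{2s}}.$$ Equivalently (to this total variation bound), for every measurable $A\subseteq\Omega$, $$\left|\int_{A\times\Omega}W(x,y)\,d\mu(x)\,d\mu(y)-p\,\mu(A)\right|\le p\sqrt{\frac{\log R}{2s}}.$$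
   Context: All underlying probability spaces $(\Omega,\mu)$ are standard and atomless (so isomorphic to $[0,1]$ with Lebesgue measure). A graphon is a symmetric measurable function $W:\Omega^2\to[0,1]$ on such a space. Graphs are finite and simple, with at least one edge; isolated vertices are deleted, so $v(H)$ denotes the number of non-isolated vertices of $H$ and $e(H)$ the number of edges. The homomorphism density is $t(H,W)=\int_{\Omega^{V(H)}}\prod_{uv\in E(H)}W(x_u,x_v)\prod_{u\in V(H)}d\mu(x_u)$, and $p(W)=t(K_2,W)=\int_{\Omega^2}W\,d\mu\,d\mu$. The degree function is $\deg_W(x)=\int_\Omega W(x,y)\,d\mu(y)$. For $k\ge1$, the tensor power $W^{\otimes k}$ is the graphon on $(\Omega^k,\mu^k)$ given by $W^{\otimes k}(x,y)=\prod_{r=1}^kW(x_r,y_r)$. For measurable $S\subseteq\Omega$ with $\alpha=\mu(S)>0$, the normalized principal restriction $W[S]$ is the graphon on $(S,\mu|_S/\alpha)$ given by $W[S](x,y)=W(x,y)$ for $x,y\in S$. A class $\mathcal C$ of graphons (considered up to measure-preserving isomorphism of the underlying standard atomless probability spaces) is admissible if: (A1) $W\in\mathcal C$ implies $W^{\otimes k}\in\mathcal C$ for every $k\ge1$; (A2) $W\in\mathcal C$ and $S$ a positive-measure measurable subset of the underlying space of $W$ imply $W[S]\in\mathcal C$. $H$ is $\mathcal C$-Sidorenko if $t(H,W)\ge p(W)^{e(H)}$ for every $W\in\mathcal C$. For probability measures $\nu\ll\mu$, $\operatorname{Ent}(\nu\mid\mu)=\int\log\left(\frac{d\nu}{d\mu}\right)d\nu=\int\frac{d\nu}{d\mu}\log\left(\frac{d\nu}{d\mu}\right)d\mu$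 is relative entropy (natural logarithm), and $\|\nu-\mu\|_{\mathrm{TV}}=\sup_A|\nu(A)-\mu(A)|$, the supremum over measurable sets $A$. *)

(* Defs.v *)
From HB Require Import structures.
From mathcomp Require Import all_boot all_order all_algebra.
From mathcomp Require Import all_classical all_reals all_analysis.
From mathcomp Require Import measurable_realfun.

Set Implicit Arguments.
Unset Strict Implicit.
Unset Printing Implicit Defensive.

Import Order.TTheory GRing.Theory Num.Theory.
Import numFieldNormedType.Exports.

Local Open Scope classical_set_scope.
Local Open Scope ring_scope.

Section power_probability.
Context d (T : measurableType d) (R : realType).

Definition tuple_cons n (p : T * n.-tuple T) : n.+1.-tuple T :=
  [the n.+1.-tuple T of p.1 :: p.2].

Let measurable_tuple_cons n : measurable_fun setT (@tuple_cons n).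
Proof. exact: measurable_cons. Qed.

HB.instance Definition _ n :=
  isMeasurableFun.Build _ _ _ _ (@tuple_cons n) (@measurable_tuple_cons n).

(* The product measure P^n on n.-tuple T: the image of P \x P^(n-1) under
   (x, t) |-> x :: t. *)
Fixpoint power_prob (P : probability T R) n : probability (n.-tuple T) R :=
  match n with
  | 0%N => \d_([tuple] : 0.-tuple T)
  | m.+1 => distribution (P \x power_prob P m)%E (@tuple_cons m)
  end.

End power_probability.

Section conditional_space.
Context d (T : measurableType d) (R : realType) (P : probability T R).
Variables (S : set T) (S_gt0 : (0 < P S)%E).

Let S_neq0 : S !=set0.
Proof.
by apply/set0P/eqP => S0; move: S_gt0; rewrite S0 measure0 ltxx.
Qed.

(* S_gt0 is only used to provide the point required by measurableType. *)
Definition cond_carrier of (0 < P S)%E := set_type S.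

HB.instance Definition _ := Choice.on (cond_carrier S_gt0).
HB.instance Definition _ := isPointed.Build (cond_carrier S_gt0)
  (exist _ (sval (cid S_neq0)) (mem_set (svalP (cid S_neq0)))).

Definition cond_val (x : cond_carrier S_gt0) : T := set_val x.

Definition cond_space := g_sigma_algebra_preimageType cond_val.

Definition cond_measure (mS : measurable S) (A : set cond_space) : \bar R :=
  ((fine (P S))^-1%:E * P (cond_val @` A))%E.

Variable mS : measurable S.

Let measurable_image (A : set cond_space) :
  measurable A -> measurable (cond_val @` A).
Proof.
move=> [B mB] <-; rewrite setTI.
rewrite (_ : _ @` _ = S `&` B); first exact: measurableI.
apply/seteqP; split => [_ [x /= Bx <-]|x [Sx Bx]].
  by split => //; exact: set_valP.
by exists (exist _ x (mem_set Sx)).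
Qed.

Let cond_val_inj : injective cond_val.
Proof. by move=> x y xy; apply: val_inj. Qed.

Let cond_measure0 : cond_measure mS set0 = 0%E.
Proof. by rewrite /cond_measure image_set0 measure0 mule0. Qed.

Let cond_measure_ge0 A : (0 <= cond_measure mS A)%E.
Proof. by rewrite mule_ge0// lee_fin invr_ge0 fine_ge0. Qed.

Let cond_measure_additive : semi_sigma_additive (cond_measure mS).
Proof.
move=> F mF tF mUF; rewrite /cond_measure image_bigcup.
under eq_fun do rewrite -ge0_sume_distrr//.
apply: cvgeZl => //; apply: measure_semi_sigma_additive.
- by move=> n; exact: measurable_image.
- apply/trivIsetP => i j _ _ ij.
  move/trivIsetP : tF => /(_ i j I I ij) FiFj.
  rewrite -subset0 => _ [[x Fix <-] [y Fjy /cond_val_inj yx]].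
  have : (F i `&` F j) x by split => //; rewrite -yx.
  by rewrite FiFj.
- by rewrite -image_bigcup; exact: measurable_image.
Qed.

HB.instance Definition _ := isMeasure.Build _ _ _ (cond_measure mS)
  cond_measure0 cond_measure_ge0 cond_measure_additive.

Let cond_measure_setT : cond_measure mS setT = 1%E.
Proof.
rewrite /cond_measure (_ : _ @` _ = S).
  rewrite -[X in (_ * X)%E]fineK ?fin_num_measure// -EFinM mulVf//.
  by rewrite gt_eqF// fine_gt0// S_gt0 ltey_eq fin_num_measure.
apply/seteqP; split => [_ [x _ <-]|x Sx]; first exact: set_valP.
by exists (exist _ x (mem_set Sx)).
Qed.

HB.instance Definition _ :=
  Measure_isProbability.Build _ _ _ (cond_measure mS) cond_measure_setT.

End conditional_space.

(* A symmetric measurable kernel with values in [0, 1] on a probability space;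
   that the space is standard and atomless is [standard_atomless] below, which
   [admissible] imposes on all the members of a class. *)
Record graphon (R : realType) := Graphon {
  gdisp : measure_display;
  gspace : measurableType gdisp;
  gmu : probability gspace R;
  gker :> gspace -> gspace -> R;
  gker_measurable :
    measurable_fun setT (fun z : gspace * gspace => gker z.1 z.2);
  gker_sym : forall x y, gker x y = gker y x;
  gker01 : forall x y, 0 <= gker x y <= 1 }.

Arguments gspace {R} g.
Arguments gmu {R} g.
Arguments gker_measurable {R} g.
Arguments gker_sym {R} g x y.
Arguments gker01 {R} g x y.

Section isomorphism.
Context (R : realType).

(* f is an isomorphism modulo null sets, with inverse g. *)
Definition iso_mod0 d1 d2 (T1 : measurableType d1) (T2 : measurableType d2)
    (m1 : {measure set T1 -> \bar R}) (m2 : {measure set T2 -> \bar R})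
    (f : T1 -> T2) (g : T2 -> T1) : Prop :=
  [/\ measurable_fun setT f, measurable_fun setT g,
      forall B, measurable B -> m1 (f @^-1` B) = m2 B,
      {ae m1, forall x, g (f x) = x} & {ae m2, forall y, f (g y) = y}].

(* The sigma-algebra of measurableTypeR R is the Borel one; this is Lebesgue
   measure on [0, 1] seen as a measure on R. *)
Definition lebesgue01 : {measure set (measurableTypeR R) -> \bar R} :=
  mrestr lebesgue_measure (measurable_itv `[0%R : R, 1%R]).

Definition standard_atomless d (T : measurableType d) (P : probability T R) :=
  exists f g, iso_mod0 P lebesgue01 f g.

Definition graphon_iso (G1 G2 : graphon R) : Prop :=
  exists (f : gspace G1 -> gspace G2) (g : gspace G2 -> gspace G1),
    iso_mod0 (gmu G1) (gmu G2) f g /\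
    exists2 N, (gmu G1).-negligible N &
      forall x y, ~ N x -> ~ N y -> G1 x y = G2 (f x) (f y).

End isomorphism.

Section tensor_power.
Context (R : realType) (G : graphon R) (k : nat).

Definition tensor_ker (x y : k.-tuple (gspace G)) : R :=
  \prod_(r < k) G (tnth x r) (tnth y r).

Let ker_measurable : measurable_fun setT
  (fun z : k.-tuple (gspace G) * k.-tuple (gspace G) => tensor_ker z.1 z.2).
Proof.
apply: measurable_prod => r _.
apply: (@measurableT_comp _ _ _ _ _ _ (fun z => G z.1 z.2) _
  (fun z => (tnth z.1 r, tnth z.2 r))); first exact: gker_measurable.
apply/measurable_fun_pairP; split.
  exact: (measurableT_comp (measurable_tnth r) measurable_fst).
exact: (measurableT_comp (measurable_tnth r) measurable_snd).
Qed.

Let ker_sym x y : tensor_ker x y = tensor_ker y x.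
Proof. by apply: eq_bigr => r _; exact: gker_sym. Qed.

Let ker01 x y : 0 <= tensor_ker x y <= 1.
Proof.
apply/andP; split.
  by apply: prodr_ge0 => r _; have /andP[] := gker01 G (tnth x r) (tnth y r).
by apply: prodr_ile1 => r _; exact: gker01.
Qed.

Definition tensor_power : graphon R :=
  @Graphon R _ _ (power_prob (gmu G) k) tensor_ker
    ker_measurable ker_sym ker01.

End tensor_power.

Section restriction.
Context (R : realType) (G : graphon R).
Variables (S : set (gspace G)) (mS : measurable S) (S_gt0 : (0 < gmu G S)%E).

Local Notation val := (@cond_val _ _ R (gmu G) S S_gt0).
Definition restriction_ker (x y : cond_space S_gt0) : R := G (val x) (val y).

Let val_measurable :
  measurable_fun setT (val : cond_space S_gt0 -> gspace G).
Proof. by move=> _ B mB; exists B. Qed.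

Let ker_measurable : measurable_fun setT
  (fun z : cond_space S_gt0 * cond_space S_gt0 => restriction_ker z.1 z.2).
Proof.
apply: (@measurableT_comp _ _ _ _ _ _ (fun z => G z.1 z.2) _
  (fun z : cond_space S_gt0 * cond_space S_gt0 => (val z.1, val z.2)));
  first exact: gker_measurable.
apply/measurable_fun_pairP; split.
  exact: (measurableT_comp val_measurable measurable_fst).
exact: (measurableT_comp val_measurable measurable_snd).
Qed.

Let ker_sym x y : restriction_ker x y = restriction_ker y x.
Proof. exact: gker_sym. Qed.

Let ker01 x y : 0 <= restriction_ker x y <= 1.
Proof. exact: gker01. Qed.

Definition restriction : graphon R :=
  @Graphon R _ _ (cond_measure mS) restriction_ker
    ker_measurable ker_sym ker01.

End restriction.

Section densities.
Context (R : realType) (G : graphon R).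

Definition edge_density : R := \int[(gmu G \x gmu G)%E]_z G z.1 z.2.

Definition degree (x : gspace G) : R := \int[gmu G]_y G x y.

Definition degree_density (x : gspace G) : R := degree x / edge_density.

Definition degree_measure (A : set (gspace G)) : \bar R :=
  (\int[gmu G]_(x in A) (degree_density x)%:E)%E.

Let edge_density_ge0 : 0 <= edge_density.
Proof. by apply: Rintegral_ge0 => z _; have /andP[] := gker01 G z.1 z.2. Qed.

Let degree_ge0 x : 0 <= degree x.
Proof. by apply: Rintegral_ge0 => y _; have /andP[] := gker01 G x y. Qed.

Let degree_density_ge0 x : 0 <= degree_density x.
Proof. exact: divr_ge0. Qed.

Let EG_measurable :
  measurable_fun setT (fun z : gspace G * gspace G => (G z.1 z.2)%:E).
Proof. by apply/measurable_EFinP; exact: gker_measurable. Qed.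

Let EG_ge0 (z : gspace G * gspace G) : (0 <= (G z.1 z.2)%:E)%E.
Proof. by rewrite lee_fin; have /andP[] := gker01 G z.1 z.2. Qed.

Let degree_measurable : measurable_fun setT degree.
Proof.
have mF := @measurable_fun_fubini_tonelli_F _ _ _ _ _ (gmu G) _
  EG_measurable EG_ge0.
exact: (measurableT_comp (fine_measurable measurableT) mF).
Qed.

Let degree_density_measurable : measurable_fun setT degree_density.
Proof. exact: measurable_funM. Qed.

Let degree_measure0 : degree_measure set0 = 0%E.
Proof. exact: integral_set0. Qed.

Let degree_measure_ge0 A : (0 <= degree_measure A)%E.
Proof. by apply: integral_ge0 => x _; rewrite lee_fin. Qed.

Let degree_measure_additive : semi_sigma_additive degree_measure.
Proof.
apply: semi_sigma_additive_nng_induced; last by move=> x; rewrite lee_fin.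
exact/measurable_EFinP.
Qed.

HB.instance Definition _ := isMeasure.Build _ _ _ degree_measure
  degree_measure0 degree_measure_ge0 degree_measure_additive.

Definition degree_distribution of 0 < edge_density := degree_measure.

Variable p_gt0 : 0 < edge_density.

HB.instance Definition _ := Measure.on (degree_distribution p_gt0).

Let degree_distribution_setT : degree_distribution p_gt0 setT = 1%E.
Proof.
have EdegreeE x : (degree x)%:E = (\int[gmu G]_y (G x y)%:E)%E.
  rewrite /degree /Rintegral fineK// ge0_fin_numE; last first.
    by apply: integral_ge0 => y _; exact: (EG_ge0 (x, y)).
  apply: (@le_lt_trans _ _ (\int[gmu G]_y (cst 1%E y))%E); last first.
    rewrite integral_cst// mul1e.
    exact: (le_lt_trans (probability_le1 (gmu G) measurableT) (ltry _)).
  apply: ge0_le_integral => //.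
  - by move=> y _; exact: (EG_ge0 (x, y)).
  - exact: (measurableT_comp EG_measurable (measurable_pair1 x)).
  - by move=> y _; rewrite lee_fin; have /andP[] := gker01 G x y.
have pE : edge_density%:E = (\int[gmu G \x gmu G]_z (G z.1 z.2)%:E)%E.
  rewrite /edge_density /Rintegral fineK// ge0_fin_numE; last first.
    by apply: integral_ge0 => z _; exact: EG_ge0.
  apply: (@le_lt_trans _ _ (\int[gmu G \x gmu G]_z (cst 1%E z))%E); last first.
    rewrite integral_cst// mul1e.
    apply: (le_lt_trans _ (ltry 1)).
    exact: (probability_le1 (gmu G \x gmu G)%E measurableT).
  apply: ge0_le_integral => //.
  by move=> z _; rewrite lee_fin; have /andP[] := gker01 G z.1 z.2.
rewrite /degree_distribution /degree_measure.
under eq_integral do rewrite /degree_density mulrC EFinM EdegreeE.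
rewrite ge0_integralZl//; last 3 first.
- exact: (@measurable_fun_fubini_tonelli_F _ _ _ _ _ (gmu G) _
  EG_measurable EG_ge0).
- by move=> x _; apply: integral_ge0 => y _; exact: (EG_ge0 (x, y)).
- by rewrite lee_fin invr_ge0.
rewrite -(@fubini_tonelli1 _ _ _ _ _ (gmu G) (gmu G) _ EG_measurable EG_ge0).
rewrite -pE -EFinM mulVf//.
by rewrite gt_eqF.
Qed.

HB.instance Definition _ := Measure_isProbability.Build _ _ _
  (degree_distribution p_gt0) degree_distribution_setT.

End densities.

(* A finite simple graph with at least one edge, whose isolated vertices have
   been deleted. *)
Record sgraph := SGraph {
  vertex : finType;
  adj : rel vertex;
  adj_sym : symmetric adj;
  adj_irr : irreflexive adj;
  adj_edge : exists u v, adj u v;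
  adj_noniso : forall u, exists v, adj u v }.

(* Each edge {u, v} is listed once, oriented by the enumeration of vertices. *)
Definition edges (H : sgraph) : {set vertex H * vertex H} :=
  [set uv | adj uv.1 uv.2 && (enum_rank uv.1 < enum_rank uv.2)%N].

Definition vertex_num (H : sgraph) : nat := #|vertex H|.
Definition edge_num (H : sgraph) : nat := #|edges H|.

Definition hom_density (R : realType) (H : sgraph) (G : graphon R) : R :=
  \int[power_prob (gmu G) #|vertex H|]_x
    \prod_(uv in edges H) G (tnth x (enum_rank uv.1)) (tnth x (enum_rank uv.2)).

Section classes.
Context (R : realType) (C : graphon R -> Prop).

Definition admissible : Prop :=
  [/\ forall G, C G -> standard_atomless (gmu G),
      forall G1 G2, graphon_iso G1 G2 -> C G1 -> C G2,
      forall G k, (1 <= k)%N -> C G -> C (tensor_power G k) &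
      forall G (S : set (gspace G)) (mS : measurable S)
        (S_gt0 : (0 < gmu G S)%E), C G -> C (restriction mS S_gt0)].

Definition sidorenko (H : sgraph) : Prop :=
  forall G, C G -> edge_density G ^+ edge_num H <= hom_density H G.

End classes.

Section entropy_and_total_variation.
Context d (T : measurableType d) (R : realType) (nu mu : probability T R).

(* The argument of ln is the density of nu with respect to mu; meaningful when
   nu is absolutely continuous with respect to mu. *)
Definition relative_entropy : \bar R :=
  (\int[nu]_x
    (ln (fine (Radon_Nikodym (charge_of_finite_measure nu) mu x)))%:E)%E.

Definition tv_distance : R :=
  sup [set `|fine (nu A) - fine (mu A)| | A in measurable].

End entropy_and_total_variation.

(* Main.v *)
Require Import Defs.
From HB Require Import structures.
From mathcomp Require Import all_boot all_order all_algebra.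
From mathcomp Require Import all_classical all_reals all_analysis.
From mathcomp Require Import measurable_realfun.
From mathcomp Require Import ring lra.

(** Write f = deg_W / p for the density of nu, n = v(H), e = e(H), and
m = 2e - n. The tensor power trick turns the Sidorenko inequality into an
entropy bound.

Apply the Sidorenko property of H to a principal restriction G[S] with
alpha = mu(S). The homomorphism density of G[S] is at most
alpha^(-n) t(H, G), and if the vertices outside S carry at most a quarter of
the total degree then the edge density of G[S] is at least
alpha^(-2) p(G) / 2. Hence (p(G) / 2)^e <= alpha^m t(H, G)
([sidorenko_restriction]): a set that carries most of the degree cannot be too
small. For G the k-th tensor power of W, both p and t(H, .) become k-th powers,
the degree is the product of the degrees of the coordinates, and nu^k gives
almost all its mass to sets whose mu^k-measure is exponentially small in k, as
soon as nu differs from mu. The constant 2^(-e) disappears in k-th roots as k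
grows. Below, R stands for t(H, W) / p^e.

The sets S are chosen as {x | sum_r h(x_r) >= 0} for a bounded function h with
nu-mean > 0. Two exponential Markov inequalities replace the law of large
numbers: mu^k(S) <= (int e^h dmu)^k, while the complement of S has nu^k-measure
at most q^k with q = int e^(-l h) dnu < 1 for a small l > 0. This gives
1 <= (int e^h dmu)^m R ([sidorenko_tilt]), and after shifting h by a constant
the variational inequality m (int h dnu - ln int e^h dmu) <= ln R, valid for
every bounded h ([sidorenko_variational]). The optimal h is ln f, which may be
unbounded below; h = ln (f + d) is bounded, costs only ln (1 + d) <= d, and
letting d tend to 0 gives m int f ln f dmu <= ln R ([entropy_le]). The integral
is the relative entropy of nu ([relative_entropy_density]).

The total variation bound follows by Pinsker's inequality ([pinsker]), and the
bound on the integral of W over A * Omega is a rewriting of it, as that integral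
is p nu(A). *)

Set Implicit Arguments.
Unset Strict Implicit.
Unset Printing Implicit Defensive.

Import Order.TTheory GRing.Theory Num.Theory.
Import numFieldNormedType.Exports.

Local Open Scope classical_set_scope.
Local Open Scope ring_scope.

Local Notation deg G := (@degree _ G).

(** * Integration on powers of a probability space *)

Section power_prob_integral.
Context d (T : measurableType d) (R : realType) (P : probability T R).
Local Open Scope ereal_scope.

Lemma measurable_tuple_cons n :
  measurable_fun setT (@tuple_cons _ T n).
Proof. exact: measurable_cons. Qed.

Lemma measurable_fun_tuple_cons d' (U : measurableType d') n
    (f : U -> T) (g : U -> n.-tuple T) :
  measurable_fun setT f -> measurable_fun setT g ->
  measurable_fun setT (fun u => tuple_cons (f u, g u)).
Proof. by move=> mf mg; exact: measurable_cons. Qed.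

Lemma integral_power_prob0 (F : 0.-tuple T -> \bar R) :
  measurable_fun setT F -> \int[power_prob P 0]_x F x = F [tuple].
Proof. by move=> mF; rewrite /= integral_dirac// diracT mul1e. Qed.

Lemma integral_power_probS n (F : n.+1.-tuple T -> \bar R) :
  measurable_fun setT F -> (forall x, 0 <= F x) ->
  \int[power_prob P n.+1]_x F x =
  \int[P]_a \int[power_prob P n]_t F (tuple_cons (a, t)).
Proof.
move=> mF F0; rewrite /= ge0_integral_distribution//.
rewrite (fubini_tonelli1 (F \o @tuple_cons _ T n)) => [//||z /=].
- by apply: measurableT_comp => //; exact: measurable_tuple_cons.
- exact: F0.
Qed.

(** Independence of the coordinates. The integrals are assumed to be real
numbers [a i] so that the product on the right is one of reals. *)
Lemma integral_power_prob_prod n (g : 'I_n -> T -> R) (a : 'I_n -> R) :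
  (forall i, measurable_fun setT (g i)) -> (forall i x, (0 <= g i x)%R) ->
  (forall i, \int[P]_x (g i x)%:E = (a i)%:E) ->
  \int[power_prob P n]_x (\prod_(i < n) g i (tnth x i))%:E =
  (\prod_(i < n) a i)%:E.
Proof.
elim: n g a => [|n IHn] g a mg g0 ga.
  under eq_integral do rewrite big_ord0.
  by rewrite integral_power_prob0 ?big_ord0.
have mprod k (g' : 'I_k -> T -> R) : (forall i, measurable_fun setT (g' i)) ->
    measurable_fun setT
      (fun x : k.-tuple T => (\prod_(i < k) g' i (tnth x i))%:E).
  move=> mg'; apply/measurable_EFinP/measurable_prod => i _.
  exact: (measurableT_comp (mg' i) (measurable_tnth i)).
rewrite integral_power_probS//; last 2 first.
- exact: mprod.
- by move=> x; rewrite lee_fin; apply: prodr_ge0.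
transitivity (\int[P]_x ((g ord0 x)%:E * (\prod_(i < n) a (lift ord0 i))%:E)).
  apply: eq_integral => x _.
  rewrite -(IHn (fun i => g (lift ord0 i)))//.
  rewrite -ge0_integralZl//; last 3 first.
  - by apply: (mprod _ (fun i => g (lift ord0 i))) => i.
  - by move=> t _; rewrite lee_fin; apply: prodr_ge0.
  - by rewrite lee_fin.
  apply: eq_integral => t _; rewrite -EFinM big_ord_recl; congr (_ * _)%:E.
  by apply: eq_bigr => i _; rewrite tnthS.
rewrite ge0_integralZr//; last 3 first.
- exact/measurable_EFinP.
- by move=> x _; rewrite lee_fin.
- rewrite lee_fin; apply: prodr_ge0 => i _.
  by rewrite -lee_fin -ga; apply: integral_ge0 => x _; rewrite lee_fin.
by rewrite ga -EFinM big_ord_recl.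
Qed.

End power_prob_integral.

Section power_prob_map.
Context d1 d2 (T1 : measurableType d1) (T2 : measurableType d2) (R : realType).
Variables (P1 : probability T1 R) (P2 : probability T2 R) (f : T1 -> T2).
Variables (c : R) (mf : measurable_fun setT f) (c0 : 0 <= c).
Hypothesis fc : forall B, measurable B -> (P1 (f @^-1` B) <= c%:E * P2 B)%E.
Local Open Scope ereal_scope.

Lemma le_integral_image_scale (F : T2 -> \bar R) :
  measurable_fun setT F -> (forall x, 0 <= F x) ->
  \int[P1]_x F (f x) <= c%:E * \int[P2]_x F x.
Proof.
move=> mF F0.
pose nnc := NngNum c0.
rewrite -[leLHS](@ge0_integral_pushforward _ _ _ _ _ _ mf P1 setT F)//.
rewrite -(@ge0_integral_mscale _ _ _ P2 setT measurableT nnc F)//.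
by apply: ge0_le_measure_integral.
Qed.

Lemma measurable_map_tuple n : measurable_fun setT (@map_tuple n _ _ f).
Proof.
apply/measurable_fun_tnthP => i.
rewrite (_ : _ \o _ = f \o (@tnth n T1 ^~ i)).
  exact: (measurableT_comp mf (measurable_tnth i)).
by apply/funext => x /=; rewrite tnth_map.
Qed.

(** Domination of an image measure by [c *: P2] passes to powers, with constant
[c ^+ n]. It is used with [f] the inclusion of a set of measure [c^-1], where
[P1] is the conditional probability. *)
Lemma le_integral_power_prob_map n (F : n.-tuple T2 -> \bar R) :
  measurable_fun setT F -> (forall x, 0 <= F x) ->
  \int[power_prob P1 n]_x F (map_tuple f x) <=
  (c ^+ n)%:E * \int[power_prob P2 n]_x F x.
Proof.
elim: n F => [|n IHn] F mF F0.
  rewrite (integral_power_prob0 P1)//; last first.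
    by apply: measurableT_comp => //; exact: measurable_map_tuple.
  rewrite integral_power_prob0// expr0 mul1e.
  by rewrite (_ : map_tuple _ _ = [tuple])//; exact: tuple0.
rewrite (integral_power_probS P1 (F := F \o @map_tuple _ _ _ f))//;
  last 2 first.
- by apply: measurableT_comp => //; exact: measurable_map_tuple.
- by move=> x; exact: F0.
rewrite integral_power_probS//.
have mG : measurable_fun setT
    (fun a : T2 => \int[power_prob P2 n]_t F (tuple_cons (a, t))).
  apply: (measurable_fun_fubini_tonelli_F (F \o @tuple_cons _ T2 n));
    last by move=> x; exact: F0.
  by apply: measurableT_comp => //; exact: measurable_tuple_cons.
have mH : measurable_fun setT (fun a : T1 =>
    \int[power_prob P1 n]_t (F \o @map_tuple _ _ _ f) (tuple_cons (a, t))).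
  apply: (measurable_fun_fubini_tonelli_F
    (F \o @map_tuple _ _ _ f \o @tuple_cons _ T1 n));
    last by move=> x; exact: F0.
  apply: measurableT_comp; last exact: measurable_tuple_cons.
  by apply: measurableT_comp => //; exact: measurable_map_tuple.
apply: (@le_trans _ _ (\int[P1]_a ((c ^+ n)%:E *
    \int[power_prob P2 n]_t F (tuple_cons (f a, t))))).
  apply: ge0_le_integral => //.
  - by move=> a _; apply: integral_ge0 => t _ /=.
  - apply: measurable_funeM.
    exact: (measurableT_comp mG mf).
  - move=> a _.
    have := IHn (fun t => F (tuple_cons (f a, t))).
    under eq_integral => t _.
      rewrite (_ : tuple_cons _ = map_tuple f (tuple_cons (a, t))); last first.
        exact: val_inj.
      over.
    apply => //.
    by apply: measurableT_comp => //; exact: measurable_fun_tuple_cons.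
rewrite ge0_integralZl//; last 3 first.
- exact: (measurableT_comp mG mf).
- by move=> a _; apply: integral_ge0.
- by rewrite lee_fin exprn_ge0.
rewrite exprSr EFinM -muleA lee_wpmul2l ?lee_fin ?exprn_ge0//.
apply: (le_integral_image_scale mG) => a.
exact: integral_ge0.
Qed.

End power_prob_map.

Section power_prob_transpose.
Context d (T : measurableType d) (R : realType) (P : probability T R).
Local Open Scope ereal_scope.

(** A tuple of tuples is seen as an array with [n] rows; an array with [k.+1]
columns is a first column together with an array with [k] columns. *)
Definition column_cons k n (z : n.-tuple T * n.-tuple (k.-tuple T)) :
    n.-tuple (k.+1.-tuple T) :=
  [tuple tuple_cons (tnth z.1 i, tnth z.2 i) | i < n].

Lemma measurable_column_cons k n :
  measurable_fun setT (@column_cons k n).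
Proof.
apply/measurable_fun_tnthP => i.
rewrite (_ : _ \o _ = fun z => tuple_cons (tnth z.1 i, tnth z.2 i)).
  apply: measurable_fun_tuple_cons.
    exact: (measurableT_comp (measurable_tnth i) measurable_fst).
  exact: (measurableT_comp (measurable_tnth i) measurable_snd).
by apply/funext => z /=; rewrite tnth_mktuple.
Qed.

Lemma column_cons_cons k n (a : T) (b : k.-tuple T) (x : n.-tuple T)
    (y : n.-tuple (k.-tuple T)) :
  column_cons (tuple_cons (a, x), tuple_cons (b, y)) =
  tuple_cons (tuple_cons (a, b), column_cons (x, y)).
Proof.
apply: eq_from_tnth => i; rewrite tnth_mktuple/=.
by case: (unliftP ord0 i) => [j|] ->; rewrite ?tnth0 ?tnthS//= tnth_mktuple.
Qed.

(** An array of independent entries can be sampled row by row or column by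
column: this identifies (P^k)^n with (P^n)^k, one column at a time. *)
Lemma integral_power_prob_column k n (F : n.-tuple (k.+1.-tuple T) -> \bar R) :
  measurable_fun setT F -> (forall x, 0 <= F x) ->
  \int[power_prob (power_prob P k.+1) n]_z F z =
  \int[power_prob P n]_x \int[power_prob (power_prob P k) n]_y
    F (column_cons (x, y)).
Proof.
elim: n F => [|n IHn] F mF F0.
  rewrite integral_power_prob0// integral_power_prob0//; last first.
    apply: (measurable_fun_fubini_tonelli_F (F \o @column_cons k 0));
      last by move=> x; exact: F0.
    by apply: measurableT_comp => //; exact: measurable_column_cons.
  rewrite integral_power_prob0//; last first.
    apply: measurableT_comp => //.
    apply: (measurableT_comp (@measurable_column_cons k 0)).
    exact: measurable_pair1.
  by congr F; rewrite [RHS]tuple0.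
have mFc : measurable_fun setT (F \o @tuple_cons _ _ n).
  by apply: measurableT_comp => //; exact: measurable_tuple_cons.
rewrite integral_power_probS// integral_power_probS//; last 2 first.
- apply: (measurable_fun_fubini_tonelli_F (F \o @tuple_cons _ _ n)) => // x.
  exact: F0.
- by move=> z; apply: integral_ge0.
rewrite integral_power_probS//; last 2 first.
- apply: (measurable_fun_fubini_tonelli_F (F \o @column_cons k n.+1));
    last by move=> x; exact: F0.
  by apply: measurableT_comp => //; exact: measurable_column_cons.
- by move=> x; apply: integral_ge0.
apply: eq_integral => a _.
transitivity (\int[power_prob P k]_b \int[power_prob P n]_x
    \int[power_prob (power_prob P k) n]_y
    F (tuple_cons (tuple_cons (a, b), column_cons (x, y)))).
  apply: eq_integral => b _; rewrite IHn//.
  by apply: measurableT_comp => //; exact: measurable_fun_tuple_cons.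
have mK : measurable_fun setT
    (fun u : (k.-tuple T * n.-tuple T) * n.-tuple (k.-tuple T) =>
       F (tuple_cons (tuple_cons (a, u.1.1), column_cons (u.1.2, u.2)))).
  apply: measurableT_comp => //; apply: measurable_fun_tuple_cons.
    by apply: measurable_fun_tuple_cons => //; exact: measurableT_comp.
  apply: (measurableT_comp (@measurable_column_cons k n)).
  by apply: measurable_fun_pair => //; exact: measurableT_comp.
rewrite (fubini_tonelli (m1 := power_prob P k) (m2 := power_prob P n)
  (fun u => \int[power_prob (power_prob P k) n]_y
    F (tuple_cons (tuple_cons (a, u.1), column_cons (u.2, y)))))//;
  last 2 first.
- exact: (measurable_fun_fubini_tonelli_F (fun u : _ * _ =>
    F (tuple_cons (tuple_cons (a, u.1.1), column_cons (u.1.2, u.2))))).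
- by move=> u; apply: integral_ge0.
apply: eq_integral => x _ /=; rewrite integral_power_probS//; last first.
  apply: measurableT_comp => //.
  apply: (measurableT_comp (@measurable_column_cons k n.+1)).
  exact: measurable_pair1.
by under [RHS]eq_integral do under eq_integral do rewrite column_cons_cons.
Qed.

End power_prob_transpose.

(** * Integrals defining graphon densities *)

Section bounded_integral.
Context d (T : measurableType d) (R : realType) (P : probability T R).

Lemma bounded_integrable (f : T -> R) (M : R) :
  measurable_fun setT f -> (forall x, `|f x| <= M) ->
  P.-integrable setT (EFin \o f).
Proof.
move=> mf fM.
apply: (@le_integrable _ _ _ P _ measurableT _ (EFin \o cst M)).
- exact/measurable_EFinP.
- by move=> x _ /=; rewrite lee_fin (le_trans (fM x))// ler_norm.
- exact: finite_measure_integrable_cst.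
Qed.

Lemma EFin_Rintegral (D : set T) (f : T -> R) : measurable D ->
  P.-integrable D (EFin \o f) ->
  (\int[P]_(x in D) f x)%:E = (\int[P]_(x in D) (f x)%:E)%E.
Proof. by move=> mD fi; rewrite fineK//; exact: integrable_fin_num. Qed.

Lemma Rintegral_cst1 (c : R) : \int[P]_x c = c.
Proof. by rewrite Rintegral_cst//= probability_setT mulr1. Qed.

Lemma integral_setC_split (S : set T) (F : T -> \bar R) : measurable S ->
  measurable_fun setT F -> (forall x, 0 <= F x)%E ->
  (\int[P]_x F x = \int[P]_(x in S) F x + \int[P]_(x in ~` S) F x)%E.
Proof.
move=> mS mF F0; rewrite -(setUv S) ge0_integral_setU ?setUv//.
  exact: measurableC.
by rewrite disj_set2E setICr.
Qed.

End bounded_integral.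

Section graphon_integral.
Context (R : realType).
Implicit Types (G : graphon R) (H : sgraph).

Lemma gker_ge0 G x y : 0 <= G x y.
Proof. by have /andP[] := gker01 G x y. Qed.

Lemma gker_le1 G x y : G x y <= 1.
Proof. by have /andP[] := gker01 G x y. Qed.

Lemma measurable_gker_section G x : measurable_fun setT (G x).
Proof.
exact: (measurableT_comp (gker_measurable G) (measurable_pair1 x)).
Qed.

Lemma EFin_edge_density G :
  (edge_density G)%:E = (\int[gmu G \x gmu G]_z (G z.1 z.2)%:E)%E.
Proof.
apply: EFin_Rintegral => //; apply: (@bounded_integrable _ _ _ _ _ 1).
  exact: gker_measurable.
by move=> z; rewrite ger0_norm ?gker_ge0// gker_le1.
Qed.

Lemma EFin_degree G x : (deg G x)%:E = (\int[gmu G]_y (G x y)%:E)%E.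
Proof.
apply: EFin_Rintegral => //; apply: (@bounded_integrable _ _ _ _ _ 1).
  exact: measurable_gker_section.
by move=> z; rewrite ger0_norm ?gker_ge0// gker_le1.
Qed.

Lemma measurable_degree G : measurable_fun setT (deg G).
Proof.
apply/measurable_EFinP; rewrite (_ : _ \o _ =
    fubini_F (gmu G) (fun z : _ * _ => (G z.1 z.2)%:E)); last first.
  by apply/funext => x /=; rewrite EFin_degree.
apply: measurable_fun_fubini_tonelli_F => [|z].
  by apply/measurable_EFinP; exact: gker_measurable.
by rewrite lee_fin gker_ge0.
Qed.

Lemma degree_ge0 G x : 0 <= deg G x.
Proof. by apply: Rintegral_ge0 => y _; exact: gker_ge0. Qed.

Lemma degree_le1 G x : deg G x <= 1.
Proof.
rewrite -lee_fin EFin_degree.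
have {1}-> : (1%:E = \int[gmu G]_y (cst 1%:E y) :> \bar R)%E.
  by rewrite integral_cst//= probability_setT mule1.
apply: ge0_le_integral => //.
- by move=> y _; rewrite lee_fin gker_ge0.
- by apply/measurable_EFinP; exact: measurable_gker_section.
- by move=> y _; rewrite lee_fin gker_le1.
Qed.

Lemma EFin_edge_density_degree G :
  (edge_density G)%:E = (\int[gmu G]_x (deg G x)%:E)%E.
Proof.
rewrite EFin_edge_density (fubini_tonelli1 (fun z => (G z.1 z.2)%:E)).
- by apply: eq_integral => x _; rewrite EFin_degree.
- by apply/measurable_EFinP; exact: gker_measurable.
- by move=> z; rewrite lee_fin gker_ge0.
Qed.

Definition hom_kernel H G (x : #|vertex H|.-tuple (gspace G)) : R :=
  \prod_(uv in edges H) G (tnth x (enum_rank uv.1)) (tnth x (enum_rank uv.2)).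

Lemma hom_kernel_ge0 H G x : 0 <= @hom_kernel H G x.
Proof. by apply: prodr_ge0 => uv _; exact: gker_ge0. Qed.

Lemma hom_kernel_le1 H G x : @hom_kernel H G x <= 1.
Proof. by apply: prodr_ile1 => uv _; exact: gker01. Qed.

Lemma measurable_hom_kernel H G : measurable_fun setT (@hom_kernel H G).
Proof.
rewrite /hom_kernel; under eq_fun do rewrite -big_enum.
apply: measurable_prod => uv _.
apply: (@measurableT_comp _ _ _ _ _ _ (fun z => G z.1 z.2) _
  (fun x => (tnth x (enum_rank uv.1), tnth x (enum_rank uv.2)))).
  exact: gker_measurable.
by apply: measurable_fun_pair; exact: measurable_tnth.
Qed.

Lemma EFin_hom_density H G : (hom_density H G)%:E =
  (\int[power_prob (gmu G) #|vertex H|]_x (@hom_kernel H G x)%:E)%E.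
Proof.
apply: EFin_Rintegral => //; apply: (@bounded_integrable _ _ _ _ _ 1).
  exact: measurable_hom_kernel.
by move=> z; rewrite ger0_norm ?hom_kernel_ge0// hom_kernel_le1.
Qed.

Lemma hom_density_ge0 H G : 0 <= hom_density H G.
Proof. by apply: Rintegral_ge0 => x _; exact: hom_kernel_ge0. Qed.

Lemma edge_density_ge0 G : 0 <= edge_density G.
Proof. by apply: Rintegral_ge0 => x _; exact: gker_ge0. Qed.

End graphon_integral.

(** * Tensor powers *)

Section tensor.
Context (R : realType).
Implicit Types (G : graphon R) (H : sgraph).

(** For fixed [x] the kernel of the tensor power is a product of functions of
the separate coordinates. *)
Lemma degree_tensor_power G k (x : k.-tuple (gspace G)) :
  deg (tensor_power G k) x = \prod_(r < k) deg G (tnth x r).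
Proof.
apply/EFin_inj; rewrite EFin_degree/=.
apply: (integral_power_prob_prod (g := fun r => G (tnth x r))) => r.
- exact: measurable_gker_section.
- by move=> y; exact: gker_ge0.
- by rewrite EFin_degree.
Qed.

Lemma edge_density_tensor_power G k :
  edge_density (tensor_power G k) = edge_density G ^+ k.
Proof.
apply/EFin_inj; rewrite EFin_edge_density_degree.
under eq_integral do rewrite degree_tensor_power.
rewrite (integral_power_prob_prod (a := fun=> edge_density G)
  (g := fun=> deg G)) => [|r|r x|r].
- by rewrite prodr_const card_ord.
- exact: measurable_degree.
- exact: degree_ge0.
- by rewrite EFin_edge_density_degree.
Qed.

Lemma hom_kernel_column_cons H G k x y :
  @hom_kernel R H (tensor_power G k.+1) (column_cons (x, y)) =
  @hom_kernel R H G x * @hom_kernel R H (tensor_power G k) y.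
Proof.
rewrite -big_split/=; apply: eq_bigr => uv _; rewrite /= /tensor_ker.
rewrite big_ord_recl !tnth_mktuple !tnth0; congr (_ * _).
by apply: eq_bigr => r _; rewrite !tnthS.
Qed.

(** The homomorphism kernel of the tensor power factors over the columns of the
array of vertex positions, so that sampling this array column by column gives
[k] independent copies of the homomorphism kernel of [G]. *)
Lemma hom_density_tensor_power H G k :
  hom_density H (tensor_power G k) = hom_density H G ^+ k.
Proof.
elim: k => [|k IHk].
  rewrite /hom_density expr0 -[RHS](Rintegral_cst1
    (power_prob (power_prob (gmu G) 0) #|vertex H|)).
  apply: eq_Rintegral => x _; rewrite big1// => uv _.
  by rewrite /= /tensor_ker big_ord0.
apply/EFin_inj; rewrite EFin_hom_density.
have mK := @measurable_hom_kernel R H.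
rewrite (@integral_power_prob_column _ _ _ (gmu G) k #|vertex H|
  (fun x => (@hom_kernel R H (tensor_power G k.+1) x)%:E)); last 2 first.
- by apply/measurable_EFinP; exact: (mK (tensor_power G k.+1)).
- by move=> x; rewrite lee_fin (hom_kernel_ge0 (G := tensor_power G k.+1)).
under eq_integral => x _.
  under eq_integral do rewrite hom_kernel_column_cons EFinM.
  rewrite ge0_integralZl//; last 3 first.
  - by apply/measurable_EFinP; exact: (mK (tensor_power G k)).
  - by move=> y _; rewrite lee_fin (hom_kernel_ge0 (G := tensor_power G k)).
  - by rewrite lee_fin hom_kernel_ge0.
  rewrite -(EFin_hom_density H (tensor_power G k)) IHk.
  over.
rewrite ge0_integralZr//.
- by rewrite -EFin_hom_density -EFinM -exprS.
- by apply/measurable_EFinP; exact: mK.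
- by move=> x _; rewrite lee_fin hom_kernel_ge0.
- by rewrite lee_fin exprn_ge0// hom_density_ge0.
Qed.

End tensor.

(** * Principal restrictions *)

Section subdegree.
Context (R : realType) (G : graphon R).

Variables (S : set (gspace G)) (mS : measurable S).

(** The degree into [S], kept extended-real as it only enters through Tonelli's
theorem. *)
Definition subdegree (x : gspace G) : \bar R :=
  (\int[gmu G]_(y in S) (G x y)%:E)%E.

Lemma subdegree_ge0 x : (0 <= subdegree x)%E.
Proof. by apply: integral_ge0 => y _; rewrite lee_fin gker_ge0. Qed.

Let f (z : gspace G * gspace G) := (G z.1 z.2 * \1_S z.2)%:E.

Let f_ge0 z : (0 <= f z)%E.
Proof. by rewrite lee_fin mulr_ge0 ?gker_ge0. Qed.

Let mf : measurable_fun setT f.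
Proof.
apply/measurable_EFinP/measurable_funM; first exact: gker_measurable.
exact: (measurableT_comp (measurable_indic mS) measurable_snd).
Qed.

Let subdegreeE x : subdegree x = (\int[gmu G]_y f (x, y))%E.
Proof.
by rewrite /subdegree integral_mkcond; apply: eq_integral => y _;
  rewrite epatch_indic.
Qed.

Lemma measurable_subdegree : measurable_fun setT subdegree.
Proof.
rewrite (_ : subdegree = fubini_F (gmu G) f); last exact/funext.
exact: measurable_fun_fubini_tonelli_F.
Qed.

(** Counting the edges with an end in [S] from the other end: symmetry of the
kernel and Tonelli. *)
Lemma integral_subdegree :
  (\int[gmu G]_x subdegree x = \int[gmu G]_(x in S) (deg G x)%:E)%E.
Proof.
under eq_integral do rewrite subdegreeE.
rewrite (fubini_tonelli f)// [RHS]integral_mkcond.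
apply: eq_integral => y _; rewrite epatch_indic/= EFin_degree.
under eq_integral do rewrite /f/= gker_sym EFinM.
rewrite ge0_integralZr//.
- by apply/measurable_EFinP; exact: measurable_gker_section.
- by move=> x _; rewrite lee_fin gker_ge0.
Qed.

End subdegree.

Section restriction.
Context (R : realType) (G : graphon R).
Variables (S : set (gspace G)) (mS : measurable S) (S_gt0 : (0 < gmu G S)%E).

Local Notation val := (@cond_val _ _ R (gmu G) S S_gt0).
Local Notation cond := (@cond_measure _ _ R (gmu G) S S_gt0 mS).
Local Notation a := (fine (gmu G S)).
Local Notation G_S := (restriction mS S_gt0).

Lemma measurable_cond_val :
  measurable_fun setT (val : cond_space S_gt0 -> gspace G).
Proof. by move=> _ B mB; exists B. Qed.

Lemma image_cond_val B : val @` (val @^-1` B) = S `&` B.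
Proof.
apply/seteqP; split => [_ [x /= Bx <-]|x [Sx Bx]].
  by split => //; exact: set_valP.
by exists (exist _ x (mem_set Sx)).
Qed.

Lemma fine_measure_gt0 : 0 < a.
Proof. by rewrite fine_gt0// S_gt0 ltey_eq fin_num_measure. Qed.

Lemma hom_kernel_restriction H x :
  @hom_kernel R H G_S x = @hom_kernel R H G (map_tuple val x).
Proof. by apply: eq_bigr => uv _; rewrite !tnth_map. Qed.

(** Forgetting the condition that all the vertices lie in [S] can only increase
the unnormalized count. *)
Lemma hom_density_restriction_le H :
  a ^+ vertex_num H * hom_density H G_S <= hom_density H G.
Proof.
have a_gt0 := fine_measure_gt0.
rewrite mulrC -ler_pdivlMr ?exprn_gt0// mulrC -exprVn -lee_fin EFinM.
rewrite !EFin_hom_density.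
under eq_integral do rewrite hom_kernel_restriction.
apply: (@le_integral_power_prob_map _ _ _ _ R cond (gmu G) val
  a^-1 _ _ _ _ (EFin \o @hom_kernel R H G)) => /=.
- exact: measurable_cond_val.
- by rewrite invr_ge0 ltW.
- move=> B mB; rewrite /cond_measure image_cond_val.
  apply: lee_wpmul2l; first by rewrite lee_fin invr_ge0 ltW.
  by apply: le_measure; rewrite ?inE//; exact: measurableI.
- by apply/measurable_EFinP; exact: measurable_hom_kernel.
- by move=> x; rewrite lee_fin hom_kernel_ge0.
Qed.

Lemma integral_cond_measure (F : gspace G -> \bar R) :
  measurable_fun setT F -> (forall x, 0 <= F x)%E ->
  (\int[gmu G]_(x in S) F x = a%:E * \int[cond]_x F (val x))%E.
Proof.
move=> mF F0; have a_gt0 := fine_measure_gt0.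
have aV_ge0 : 0 <= a^-1 by rewrite invr_ge0 ltW.
have -> : (\int[cond]_x F (val x) =
    \int[pushforward cond val]_(x in S) F x)%E.
  rewrite (ge0_integral_pushforward measurable_cond_val)//; last first.
    exact: measurable_funTS.
  congr (integral _ _ _); apply/seteqP; split => x //= _; exact: set_valP.
rewrite (@eq_measure_integral _ _ _ S (mscale (NngNum aV_ge0) (gmu G))
  (pushforward cond val)).
  rewrite ge0_integral_mscale//; last exact: measurable_funTS.
  by rewrite /= muleA -EFinM mulfV ?gt_eqF// mul1e.
  exact: measurable_cond_val.
move=> mval A mA AS; rewrite /= /pushforward /cond_measure /mscale/=.
by congr (_ * gmu G _)%E; rewrite -[RHS](setIidr AS); exact: image_cond_val.
Qed.

Lemma edge_density_restriction :
  ((a ^+ 2 * edge_density G_S)%:E =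
   \int[gmu G]_(x in S) subdegree S x)%E.
Proof.
rewrite (integral_cond_measure (measurable_subdegree mS) (subdegree_ge0 S)).
rewrite expr2 -mulrA EFinM; congr (_ * _)%E.
rewrite EFinM EFin_edge_density_degree -ge0_integralZl//; last 3 first.
- by apply/measurable_EFinP; exact: measurable_degree.
- by move=> x _; rewrite lee_fin degree_ge0.
- by rewrite lee_fin ltW// fine_measure_gt0.
apply: eq_integral => x _; rewrite EFin_degree.
rewrite -(integral_cond_measure (F := fun y => (G (val x) y)%:E))//.
- by apply/measurable_EFinP; exact: measurable_gker_section.
- by move=> y; rewrite lee_fin gker_ge0.
Qed.

(** A pair of vertices lies in [S] unless one of its two ends is outside [S],
and the pairs with a given end outside [S] weigh the integral of the degree
over the complement of [S]. *)
Lemma edge_density_restriction_ge :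
  edge_density G <= a ^+ 2 * edge_density G_S
                    + 2 * \int[gmu G]_(x in ~` S) deg G x.
Proof.
have mC : measurable (~` S) by exact: measurableC.
have mdeg : measurable_fun setT (fun x => (deg G x)%:E).
  by apply/measurable_EFinP; exact: measurable_degree.
have deg0 x : (0 <= (deg G x)%:E)%E by rewrite lee_fin degree_ge0.
have degi : (gmu G).-integrable (~` S) (EFin \o deg G).
  apply: (integrableS measurableT) => //.
  apply: (@bounded_integrable _ _ _ _ _ 1); first exact: measurable_degree.
  by move=> z; rewrite ger0_norm ?degree_ge0// degree_le1.
have msub B : measurable B -> measurable_fun S (@subdegree _ G B).
  by move=> mB; apply: measurable_funTS; exact: measurable_subdegree.
rewrite mulr_natl mulr2n -lee_fin !EFinD.
rewrite edge_density_restriction EFin_edge_density_degree EFin_Rintegral//.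
rewrite (integral_setC_split _ mS)// addeA; apply: leeD => //.
rewrite (_ : \int[gmu G]_(x in S) (deg G x)%:E = \int[gmu G]_(x in S)
    (subdegree S x + subdegree (~` S) x))%E; last first.
  apply: eq_integral => x _; rewrite EFin_degree.
  rewrite (integral_setC_split _ mS)//.
    by apply/measurable_EFinP; exact: measurable_gker_section.
  by move=> y; rewrite lee_fin gker_ge0.
rewrite ge0_integralD//; [|by move=> x _; exact: subdegree_ge0|exact: msub
  |by move=> x _; exact: subdegree_ge0|exact: msub].
apply: leeD => //; rewrite -integral_subdegree//.
apply: ge0_subset_integral => //; first exact: measurable_subdegree.
by move=> x _; exact: subdegree_ge0.
Qed.

End restriction.

(** * Exponential tilting *)

Section exponential_markov.
Context d (T : measurableType d) (R : realType) (P : probability T R).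

Definition sum_ge0 (h : T -> R) k : set (k.-tuple T) :=
  [set x | 0 <= \sum_(r < k) h (tnth x r)].

Arguments sum_ge0 : clear implicits.

Lemma measurable_sum_ge0 (h : T -> R) k : measurable_fun setT h ->
  measurable (sum_ge0 h k).
Proof.
move=> mh; rewrite -[sum_ge0 h k]setTI.
apply: (@measurable_fun_le _ _ _ setT (cst 0)
  (fun x : k.-tuple T => \sum_(r < k) h (tnth x r))) => //.
by apply: measurable_sum => r; exact: (measurableT_comp mh (measurable_tnth r)).
Qed.

(** Chernoff's bound: on the event, the product of the weights [expR (h _)] is
at least 1, and inserting it makes the integral a [k]-th power. The factor [w]
allows a change of the reference measure. *)
Lemma exponential_markov (w h : T -> R) (b : R) k :
  measurable_fun setT w -> measurable_fun setT h -> (forall x, 0 <= w x) ->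
  (\int[P]_x (w x * expR (h x))%:E = b%:E)%E ->
  (\int[power_prob P k]_(x in sum_ge0 h k) (\prod_(r < k) w (tnth x r))%:E <=
   (b ^+ k)%:E)%E.
Proof.
move=> mw mh w0 hb.
have mwh : measurable_fun setT (fun x => w x * expR (h x)).
  by apply: measurable_funM => //; exact: measurableT_comp.
have -> : b ^+ k = \prod_(r < k) b by rewrite prodr_const card_ord.
rewrite -(integral_power_prob_prod (P := P)
  (g := fun=> fun x => w x * expR (h x)) (a := fun=> b) _ _ _)//; last first.
  by move=> _ x; rewrite mulr_ge0// expR_ge0.
have mprod (u : T -> R) : measurable_fun setT u -> measurable_fun setT
    (fun x : k.-tuple T => (\prod_(r < k) u (tnth x r))%:E).
  move=> mu; apply/measurable_EFinP/measurable_prod => r _.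
  exact: (measurableT_comp mu (measurable_tnth r)).
have mS := @measurable_sum_ge0 h k mh.
apply: (@le_trans _ _ (\int[power_prob P k]_(x in sum_ge0 h k)
    (\prod_(r < k) (w (tnth x r) * expR (h (tnth x r))))%:E)%E).
  apply: ge0_le_integral => //.
  - by move=> x _; rewrite lee_fin; apply: prodr_ge0.
  - by apply: measurable_funTS; exact: mprod.
  - by apply: measurable_funTS; exact: (mprod (fun x => w x * expR (h x))).
  - move=> x Sx; rewrite lee_fin big_split/=.
    by rewrite ler_peMr ?prodr_ge0// -expR_sum -[leLHS]expR0 ler_expR.
apply: ge0_subset_integral => //.
  exact: (mprod (fun x => w x * expR (h x))).
move=> x _; rewrite lee_fin; apply: prodr_ge0 => r _.
by rewrite mulr_ge0// expR_ge0.
Qed.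

(** Since [expR (- u) >= 1 - u], [expR u] is at most [(1 - u)^-1], which lies
below this quadratic polynomial. *)
Lemma expR_le_quadratic (u : R) : u <= 2^-1 -> expR u <= 1 + u + 2 * u ^+ 2.
Proof.
move=> u2; have u1 : 0 < 1 - u by lra.
have : expR u <= (1 - u)^-1.
  by rewrite -[expR u]invrK -expRN lef_pV2 ?posrE ?expR_gt0// expR_ge1Dx.
move=> /le_trans; apply; rewrite -div1r ler_pdivrMr//.
have : 0 <= u ^+ 2 * (1 - 2 * u) by rewrite mulr_ge0 ?sqr_ge0//; lra.
nra.
Qed.

(** The function [l |-> \int f expR (- l h)] has value 1 and negative derivative
[- \int f h] at 0, hence drops below 1; the quadratic bound on [expR] makes this
quantitative. *)
Lemma exists_tilt_lt1 (f h : T -> R) (K M : R) :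
  measurable_fun setT f -> measurable_fun setT h ->
  (forall x, 0 <= f x <= K) -> (forall x, `|h x| <= M) ->
  \int[P]_x f x = 1 -> 0 < \int[P]_x (f x * h x) ->
  exists2 l, 0 < l & \int[P]_x (f x * expR (- l * h x)) < 1.
Proof.
move=> mf mh f0K hM f1 fh_gt0; set D := \int[P]_x (f x * h x) in fh_gt0 *.
have M0 : 0 <= M by rewrite (le_trans (normr_ge0 _) (hM point)).
pose N := M + D + 1; have N_gt0 : 0 < N by rewrite /N; lra.
have N0 : N != 0 by rewrite gt_eqF.
(* The integral is at most [1 - l D + 2 (l N)^2]; this [l] makes the quadratic
   term half of the linear one, and [D <= N] gives [l N <= 1/4]. *)
pose l := D / (4 * N ^+ 2).
have l_gt0 : 0 < l by rewrite divr_gt0// mulr_gt0// exprn_gt0.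
have lN : l * N <= 2^-1.
  rewrite (_ : l * N = D / (4 * N)); last by rewrite /l; field.
  rewrite ler_pdivrMr ?mulr_gt0// /N; lra.
have lN2 : l * N ^+ 2 = D / 4 by rewrite /l; field.
exists l => //.
have fi : P.-integrable setT (EFin \o f).
  apply: (@bounded_integrable _ _ _ _ _ K) => // x.
  by have /andP[f0 fK] := f0K x; rewrite ger0_norm.
have fhi : P.-integrable setT (EFin \o (fun x => f x * h x)).
  apply: (@bounded_integrable _ _ _ _ _ (K * M)) => [|x].
    exact: measurable_funM.
  have /andP[f0 fK] := f0K x.
  by rewrite normrM ger0_norm// ler_pM.
have lhN x : `|- l * h x| <= 2^-1.
  rewrite normrM normrN (gtr0_norm l_gt0) (le_trans _ lN)//.
  rewrite ler_pM2l// (le_trans (hM x))// /N; lra.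
pose c := 1 + 2 * (l * N) ^+ 2.
have cfi : P.-integrable setT (EFin \o (fun x => c * f x)).
  exact: (integrableZl measurableT c fi).
have lfhi : P.-integrable setT (EFin \o (fun x => l * (f x * h x))).
  exact: (integrableZl measurableT l fhi).
apply: (@le_lt_trans _ _ (\int[P]_x (c * f x - l * (f x * h x)))).
  apply: le_Rintegral => //.
  - apply: (@bounded_integrable _ _ _ _ _ (K * expR 2^-1)) => [|x].
      apply: measurable_funM => //; apply: measurableT_comp => //.
      exact: measurable_funM.
    have /andP[f0 fK] := f0K x.
    rewrite normrM !ger0_norm ?expR_ge0// ler_pM ?expR_ge0// ler_expR.
    exact: le_trans (ler_norm _) (lhN x).
  - exact: (integrableB measurableT cfi lfhi).
  - move=> x _; have /andP[f0 fK] := f0K x.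
    rewrite (_ : c * _ - _ = f x * (c - l * h x)); last by rewrite /c; ring.
    rewrite ler_wpM2l//.
    rewrite (le_trans (expR_le_quadratic (le_trans (ler_norm _) (lhN x))))//.
    rewrite /c mulNr sqrrN addrAC lerD2r lerD2l ler_pM2l//.
    rewrite -[leLHS]real_normK ?num_real// ler_pXn2r ?nnegrE//; last first.
      by rewrite mulr_ge0 // ltW.
    rewrite normrM (gtr0_norm l_gt0) ler_pM2l// (le_trans (hM x))// /N; lra.
rewrite RintegralB//= !RintegralZl// f1 mulr1 -/D /c exprMn.
have -> : l ^+ 2 * N ^+ 2 = l * (D / 4) by rewrite -lN2; ring.
have := mulr_gt0 l_gt0 fh_gt0; lra.
Qed.

End exponential_markov.

Arguments sum_ge0 {d T R} h k _.

Lemma exprn_lt_eps (R : realType) (x e : R) : 0 <= x < 1 -> 0 < e ->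
  exists2 k, (1 <= k)%N & x ^+ k < e.
Proof.
move=> /andP[x0 x1] e0.
have /cvgrPdist_lt/(_ _ e0)[k _ kP] : (x ^+ n @[n --> \oo] --> 0)%classic.
  by apply: cvg_expr; rewrite ger0_norm.
exists k.+1 => //; have := kP k.+1 (leqnSn k).
by rewrite /= sub0r normrN ger0_norm// exprn_ge0.
Qed.

(** * Pinsker's inequality *)

Section pinsker.
Context (R : realType).

(** The derivative of the left-hand function is
[(y - 1)^3 / (y^2 (y + 2)^2)], so that it attains its minimum, which is 0,
at [y = 1]. The rational part is the partial fraction decomposition of
[- (y - 1) (5 y + 1) / (2 y (y + 2))]. *)
Lemma ln_ge_pinsker (y : R) : 0 < y ->
  0 <= ln y + (4^-1 * y^-1 + 27 / 4 * (y + 2)^-1) - 5 / 2.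
Proof.
pose F (x : R) : R := ln x + (4^-1 * x^-1 + 27 / 4 * (x + 2)^-1).
pose dF (x : R) : R := (x - 1) ^+ 3 / (x ^+ 2 * (x + 2) ^+ 2).
have F1 : F 1 = 5 / 2 by rewrite /F ln1; field.
have dFE (x : R) : 0 < x -> is_derive x (1 : R) F (dF x).
  move=> x0; have x2 : x + 2 != 0 by rewrite gt_eqF//; lra.
  have xn0 : x != 0 by rewrite gt_eqF.
  have lnx := is_derive1_ln x0.
  have Vx : is_derive x (1 : R) (fun z => z^-1) (- x ^- 2 *: 1).
    exact: is_deriveV.
  have V2x : is_derive x (1 : R) (fun z => (z + 2)^-1)
      (- (x + 2) ^- 2 *: (1 + 0)).
    exact: is_deriveV.
  rewrite (_ : dF x = x^-1 + (4^-1 *: (- x ^- 2 *: 1)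
    + (27 / 4) *: (- (x + 2) ^- 2 *: (1 + 0)))).
    exact: is_deriveD.
  rewrite /dF /GRing.scale/=; field; exact/andP.
have cF (a b : R) : 0 < a -> {within `[a, b], continuous F}.
  move=> a0; apply: derivable_within_continuous => x.
  rewrite in_itv/= => /andP[ax _].
  by apply: ex_derive; apply: dFE; exact: lt_le_trans ax.
move=> y0; suff : F 1 <= F y by rewrite F1 /F; lra.
have den (x : R) : 0 < x -> 0 < x ^+ 2 * (x + 2) ^+ 2.
  by move=> x0; rewrite mulr_gt0 ?exprn_gt0//; lra.
have [y1|y1] := leP 1 y.
  have [||c] := @MVT_segment R F dF 1 y y1.
  - by move=> x; rewrite in_itv/= => /andP[x1 _]; apply: dFE; lra.
  - exact: cF.
  rewrite in_itv/= => /andP[c1 _] FE; rewrite -subr_ge0 FE mulr_ge0 ?subr_ge0//.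
  by rewrite divr_ge0 ?exprn_ge0 ?subr_ge0// ltW// den//; lra.
have [||c] := @MVT_segment R F dF y 1 (ltW y1).
- by move=> x; rewrite in_itv/= => /andP[x1 _]; apply: dFE; lra.
- exact: cF.
rewrite in_itv/= => /andP[yc c1] FE; rewrite -subr_le0 FE.
rewrite mulr_le0_ge0 ?subr_ge0 ?(ltW y1)// mulr_le0_ge0//; last first.
  by rewrite invr_ge0 ltW// den//; lra.
by rewrite exprSr mulr_ge0_le0 ?sqr_ge0//; lra.
Qed.

(** For [y > 0] the difference of the two sides is [2 y (y + 2)] times the
function of [ln_ge_pinsker]; at [y = 0], where [y ln y = 0], it is 1. *)
Lemma pinsker_pointwise (y : R) : 0 <= y ->
  3 * (y - 1) ^+ 2 <= (4 + 2 * y) * (y * ln y - y + 1).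
Proof.
rewrite le_eqVlt => /predU1P[<-|y0]; first by rewrite mul0r; lra.
have y2 : y + 2 != 0 by rewrite gt_eqF//; lra.
have yn0 : y != 0 by rewrite gt_eqF.
rewrite -subr_ge0.
rewrite (_ : _ - _ = 2 * y * (y + 2) *
    (ln y + (4^-1 * y^-1 + 27 / 4 * (y + 2)^-1) - 5 / 2)); last first.
  by field; exact/andP.
by rewrite mulr_ge0 ?ln_ge_pinsker// !mulr_ge0//; lra.
Qed.

Lemma xlnx_ge (y : R) : 0 <= y -> y - 1 <= y * ln y.
Proof.
rewrite le_eqVlt => /predU1P[<-|y0]; first by rewrite mul0r; lra.
have yV : 0 < y^-1 by rewrite invr_gt0.
have : ln (1 + (y^-1 - 1)) <= y^-1 - 1 by apply: le_ln1Dx; lra.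
rewrite addrC subrK lnV ?posrE// => /(ler_wpM2l (ltW y0)).
rewrite mulrBr mulfV ?gt_eqF//; lra.
Qed.

Lemma xlnx_le_sqr (y : R) : 0 <= y -> y * ln y <= y ^+ 2.
Proof.
rewrite le_eqVlt => /predU1P[<-|y0]; first by rewrite mul0r expr0n.
by rewrite expr2 ler_pM2l// ltW// ln_sublinear.
Qed.

Context d (T : measurableType d) (P : probability T R).

Lemma integrable_xlnx (f : T -> R) (K : R) : measurable_fun setT f ->
  (forall x, 0 <= f x <= K) ->
  P.-integrable setT (EFin \o (fun x => f x * ln (f x))).
Proof.
move=> mf f0K; apply: (@bounded_integrable _ _ _ _ _ (1 + K ^+ 2)) => [|x].
  apply: measurable_funM => //.
  exact: (measurableT_comp (@measurable_ln R) mf).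
have /andP[f0 fK] := f0K x.
have := xlnx_ge f0; have := xlnx_le_sqr f0.
have : f x ^+ 2 <= K ^+ 2 by rewrite lerXn2r ?nnegrE// (le_trans f0).
have := sqr_ge0 (f x); rewrite ler_norml; lra.
Qed.

(** With [e] the difference of the two measures of [A] and [t] the function
equal to 1 on [A] and to -1 elsewhere, [2 e = \int t (f - 1)]. The pointwise
inequality bounds [(f - 1)^2] by the product of [u = (4 + 2 f) / 3], of
integral 2, and [v = f ln f - f + 1], of integral [D]. The Cauchy-Schwarz
inequality would conclude; it is used in its weighted AM-GM form
[2 |f - 1| <= c u + v / c], integrated with the weight [c = |e|]. *)
Lemma pinsker (f : T -> R) (K : R) (A : set T) : measurable_fun setT f ->
  (forall x, 0 <= f x <= K) -> \int[P]_x f x = 1 -> measurable A ->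
  2 * (\int[P]_(x in A) f x - fine (P A)) ^+ 2 <= \int[P]_x (f x * ln (f x)).
Proof.
move=> mf f0K f1 mA; set D := \int[P]_x (f x * ln (f x)).
have fi : P.-integrable setT (EFin \o f).
  apply: (@bounded_integrable _ _ _ _ _ K) => // x.
  by have /andP[f0 fK] := f0K x; rewrite ger0_norm.
have ci (c : R) : P.-integrable setT (EFin \o cst c).
  exact: finite_measure_integrable_cst.
have Di := integrable_xlnx mf f0K.
pose e := \int[P]_(x in A) f x - fine (P A).
pose t x : R := 2 * \1_A x - 1.
pose g x := t x * (f x - 1).
have mt : measurable_fun setT t.
  by apply: measurable_funB => //; apply: measurable_funM.
have t1 x : `|t x| = 1.
  by rewrite /t indicE; case: (_ \in _); rewrite /= ?normr1 ?mulr1 ?mulr0;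
     rewrite ?sub0r ?normrN ?normr1// ger0_norm; lra.
have f1K x : `|f x - 1| <= K + 1.
  have /andP[f0 fK] := f0K x.
  by rewrite (le_trans (ler_normB _ _))// normr1 lerD2r ger0_norm.
have mf1 : measurable_fun setT (fun x => f x - 1) by exact: measurable_funB.
have f1i : P.-integrable setT (EFin \o (fun x => f x - 1)).
  exact: bounded_integrable f1K.
have gi : P.-integrable setT (EFin \o g).
  apply: (@bounded_integrable _ _ _ _ _ (K + 1)) => [|x].
    exact: measurable_funM.
  by rewrite normrM t1 mul1r.
have gE : \int[P]_x g x = 2 * e.
  have i1 : P.-integrable setT (EFin \o (fun x => (f x - 1) * \1_A x)).
    apply: (@bounded_integrable _ _ _ _ _ (K + 1)) => [|x].
      exact: measurable_funM.
    rewrite normrM -[leRHS]mulr1 ler_pM// indicE.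
    by case: (_ \in _); rewrite ?normr1 ?normr0.
  transitivity (\int[P]_x (2 * ((f x - 1) * \1_A x) - (f x - 1))).
    by apply: eq_Rintegral => x _; rewrite /g /t; ring.
  rewrite RintegralB//; last exact: (integrableZl measurableT 2 i1).
  rewrite RintegralZl// [X in _ - X]RintegralB//; last exact: ci.
  rewrite /= f1 Rintegral_cst1 subrr subr0.
  rewrite -(_ : \int[P]_(x in A) (f x - 1) = \int[P]_x ((f x - 1) * \1_A x)).
    have iA h : P.-integrable setT (EFin \o h) -> P.-integrable A (EFin \o h).
      exact: integrableS.
    rewrite RintegralB//; [|exact: iA|exact/iA/ci].
    by rewrite Rintegral_cst// mul1r.
  by rewrite Rintegral_mkcond; apply: eq_Rintegral => x _; rewrite patch_indic.
rewrite -/e; have [->|e0] := eqVneq e 0.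
  rewrite expr0n mulr0.
  have : \int[P]_x (f x - 1) <= D.
    by apply: le_Rintegral => // x _; apply: xlnx_ge; have /andP[] := f0K x.
  by rewrite RintegralB//=; [rewrite f1 Rintegral_cst1 subrr|exact: ci].
pose c := `|e|; have c0 : 0 < c by rewrite normr_gt0.
have cn0 : c != 0 by rewrite gt_eqF.
pose G x := (c / 3) * f x + (2 * c / 3 + c^-1 / 2)
  + (c^-1 / 2) * (f x * ln (f x)) - (c^-1 / 2) * f x.
have Z (k : R) h : P.-integrable setT (EFin \o h) ->
    P.-integrable setT (EFin \o (fun x => k * h x)).
  by move=> hi; exact: (integrableZl measurableT k hi).
have Dd (h1 h2 : T -> R) : P.-integrable setT (EFin \o h1) ->
    P.-integrable setT (EFin \o h2) ->
    P.-integrable setT (EFin \o (fun x => h1 x + h2 x)).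
  by move=> h1i h2i; exact: (integrableD measurableT h1i h2i).
have B (h1 h2 : T -> R) : P.-integrable setT (EFin \o h1) ->
    P.-integrable setT (EFin \o h2) ->
    P.-integrable setT (EFin \o (fun x => h1 x - h2 x)).
  by move=> h1i h2i; exact: (integrableB measurableT h1i h2i).
have Gi : P.-integrable setT (EFin \o G).
  exact: (B _ _ (Dd _ _ (Dd _ _ (Z _ _ fi) (ci _)) (Z _ _ Di)) (Z _ _ fi)).
have GE : \int[P]_x G x = c + c^-1 / 2 * D.
  rewrite RintegralB//; [|exact: (Dd _ _ (Dd _ _ (Z _ _ fi) (ci _)) (Z _ _ Di))
    |exact: (Z _ _ fi)].
  rewrite RintegralD//; [|exact: (Dd _ _ (Z _ _ fi) (ci _))
    |exact: (Z _ _ Di)].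
  rewrite RintegralD//; [|exact: (Z _ _ fi)|exact: ci].
  rewrite !RintegralZl//= f1 Rintegral_cst1 -/D; lra.
have gG x : `|g x| <= G x.
  rewrite normrM t1 mul1r.
  have /andP[f0 _] := f0K x; have := pinsker_pointwise f0.
  have := xlnx_ge f0; rewrite /G.
  move: (f x * ln (f x)) => u u1 pp.
  have : 0 <= (u - f x + 1) by lra.
  set b := u - f x + 1 => b0.
  have pb : (f x - 1) ^+ 2 <= (4 + 2 * f x) / 3 * b by rewrite /b; lra.
  rewrite [leRHS](_ : _ = (c * ((4 + 2 * f x) / 3) + c^-1 * b) / 2); last first.
    by rewrite /b; field.
  rewrite -[leRHS]ger0_norm; last first.
    by rewrite divr_ge0// addr_ge0 ?mulr_ge0 ?invr_ge0 ?(ltW c0)//; lra.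
  rewrite -ler_sqr ?nnegrE// !real_normK ?num_real// (le_trans pb)//.
  set a := (4 + 2 * f x) / 3.
  have : 0 <= (c * a - c^-1 * b) ^+ 2 by exact: sqr_ge0.
  have -> : (c * a - c^-1 * b) ^+ 2 = (c * a + c^-1 * b) ^+ 2 - 4 * (a * b).
    by field.
  lra.
have : `|\int[P]_x g x| <= \int[P]_x G x.
  rewrite (le_trans (le_normr_Rintegral measurableT gi))//.
  apply: le_Rintegral => //.
  exact: (integrable_norm gi).
rewrite gE GE normrM ger0_norm// -/c => ineq.
have : c * (2 * c) <= c * (c + c^-1 / 2 * D) by rewrite ler_pM2l.
rewrite (_ : c * (c + _) = c ^+ 2 + D / 2); last by field.
by rewrite -[e ^+ 2]real_normK ?num_real// -/c; lra.
Qed.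

End pinsker.

(** * The entropy bound *)

Section sidorenko.
Context (R : realType) (C : graphon R -> Prop) (H : sgraph) (m : nat).
Hypotheses (C_adm : admissible C) (H_sid : sidorenko C H).
Hypothesis vmE : (vertex_num H + m = 2 * edge_num H)%N.

(** The Sidorenko inequality for the restriction of [G] to [S], cleared of its
normalizations: the edge side carries [alpha ^ (2e)], the homomorphism side
[alpha ^ n], and [alpha ^ m] is what remains. The bound on the degree outside
[S] forces [alpha > 0] and makes the base on the left positive. *)
Lemma sidorenko_restriction (G : graphon R) (S : set (gspace G)) :
  C G -> measurable S ->
  2 * \int[gmu G]_(x in ~` S) deg G x < edge_density G ->
  (edge_density G - 2 * \int[gmu G]_(x in ~` S) deg G x) ^+ edge_num H
    <= fine (gmu G S) ^+ m * hom_density H G.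
Proof.
move=> CG mS; set D := \int[gmu G]_(x in ~` S) deg G x => Dlt.
have D0 : 0 <= D by apply: Rintegral_ge0 => x _; exact: degree_ge0.
have S_gt0 : (0 < gmu G S)%E.
  rewrite lt0e measure_ge0 andbT; apply/eqP => S0.
  have : edge_density G <= D; last by lra.
  rewrite -lee_fin EFin_edge_density_degree.
  have mdeg : measurable_fun setT (fun x => (deg G x)%:E).
    by apply/measurable_EFinP; exact: measurable_degree.
  have deg0 x : (0 <= (deg G x)%:E)%E by rewrite lee_fin degree_ge0.
  rewrite (integral_setC_split _ mS)// null_set_integral//; last first.
    exact: measurable_funTS.
  rewrite add0e EFin_Rintegral//; first exact: measurableC.
  apply: (integrableS measurableT) => //; first exact: measurableC.
  apply: (@bounded_integrable _ _ _ _ _ 1); first exact: measurable_degree.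
  by move=> z; rewrite ger0_norm ?degree_ge0// degree_le1.
have a_gt0 := fine_measure_gt0 mS S_gt0.
have [_ _ _ /(_ G S mS S_gt0 CG) C_S] := C_adm.
have := edge_density_restriction_ge mS S_gt0; rewrite -/D => pa.
apply: (@le_trans _ _ ((fine (gmu G S) ^+ 2 *
    edge_density (restriction mS S_gt0)) ^+ edge_num H)).
  by rewrite lerXn2r ?nnegrE ?mulr_ge0 ?exprn_ge0 ?edge_density_ge0//; lra.
rewrite exprMn -exprM -vmE addnC exprD -mulrA ler_pM2l ?exprn_gt0//.
rewrite (le_trans _ (hom_density_restriction_le mS S_gt0 H))//.
by rewrite ler_pM2l ?exprn_gt0// H_sid.
Qed.

Variables (W : graphon R) (CW : C W) (p_gt0 : 0 < edge_density W).

Local Notation mu := (gmu W).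
Local Notation p := (edge_density W).
Local Notation f := (@degree_density _ W).
Local Notation Rat := (hom_density H W / p ^+ edge_num H).

Lemma degree_density_ge0 x : 0 <= f x.
Proof. by rewrite divr_ge0 ?degree_ge0// ltW. Qed.

Lemma degree_density_bound x : 0 <= f x <= p^-1.
Proof.
rewrite degree_density_ge0/= /degree_density ler_pdivrMr// mulVf ?gt_eqF//.
exact: degree_le1.
Qed.

Lemma measurable_degree_density : measurable_fun setT f.
Proof. by apply: measurable_funM => //; exact: measurable_degree. Qed.

Lemma integrable_degree_density : mu.-integrable setT (EFin \o f).
Proof.
apply: (@bounded_integrable _ _ _ _ _ p^-1) => [|x].
  exact: measurable_degree_density.
by have /andP[f0 fp] := degree_density_bound x; rewrite ger0_norm.
Qed.

Lemma integral_degree_density : \int[mu]_x f x = 1.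
Proof.
apply/EFin_inj; rewrite EFin_Rintegral//; last exact: integrable_degree_density.
exact: (probability_setT (degree_distribution p_gt0)).
Qed.

(** The tensor power trick. If the right-hand side were below 1, then for a
large [k] the set of [x] in Omega^k with [\sum_r h (x_r) >= 0] would carry at
least three quarters of the total degree of the [k]-th tensor power of [W], and
still be too small for [sidorenko_restriction]. *)
Lemma sidorenko_tilt (h : gspace W -> R) (M : R) :
  measurable_fun setT h -> (forall x, `|h x| <= M) ->
  0 < \int[mu]_x (f x * h x) ->
  1 <= (\int[mu]_x expR (h x)) ^+ m * Rat.
Proof.
move=> mh hM fh_gt0.
have [l l_gt0 q_lt1] := exists_tilt_lt1 measurable_degree_density mh
  degree_density_bound hM integral_degree_density fh_gt0.
set q := \int[mu]_x _ in q_lt1; set b := \int[mu]_x expR (h x).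
have mlh : measurable_fun setT (fun x => - l * h x) by exact: measurable_funM.
have q0 : 0 <= q.
  apply: Rintegral_ge0 => x _.
  by rewrite mulr_ge0 ?degree_density_ge0 ?expR_ge0.
have b0 : 0 <= b by apply: Rintegral_ge0 => x _; exact: expR_ge0.
have bE : (\int[mu]_x (1 * expR (h x))%:E = b%:E)%E.
  under eq_integral do rewrite mul1r.
  rewrite EFin_Rintegral//; apply: (@bounded_integrable _ _ _ _ _ (expR M)).
    exact: measurableT_comp.
  by move=> x; rewrite ger0_norm ?expR_ge0// ler_expR (le_trans (ler_norm _)).
have qE : (\int[mu]_x (deg W x * expR (- l * h x))%:E = (p * q)%:E)%E.
  have qi : mu.-integrable setT (EFin \o (fun x => f x * expR (- l * h x))).
    apply: (@bounded_integrable _ _ _ _ _ (p^-1 * expR (l * M))) => [|x].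
      apply: measurable_funM; first exact: measurable_degree_density.
      exact: measurableT_comp.
    have /andP[f0 fp] := degree_density_bound x.
    rewrite ger0_norm; last exact: (mulr_ge0 f0 (expR_ge0 _)).
    rewrite ler_pM ?expR_ge0// ler_expR.
    rewrite (le_trans (ler_norm _))// normrM normrN (gtr0_norm l_gt0).
    by rewrite ler_pM2l.
  rewrite -RintegralZl// EFin_Rintegral//; last exact: (integrableZl _ _ qi).
  apply: eq_integral => x _; rewrite mulrA /degree_density.
  by rewrite [p * _]mulrC divfK ?gt_eqF.
rewrite leNgt; apply/negP => lt1.
have Rat0 : 0 <= Rat by rewrite divr_ge0 ?hom_density_ge0// exprn_ge0// ltW.
(* One [k] has to serve for both geometric sequences; the threshold is small
   enough for the complement of [S] to carry at most a quarter of the degree and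
   for the factor [(1 / 2) ^ e] lost in the restriction to be absorbed. *)
pose z := Num.max q (b ^+ m * Rat).
have z01 : 0 <= z < 1 by rewrite /z le_max q0 gt_max q_lt1 lt1.
have z0 : 0 <= z by case/andP: z01.
have e_gt0 : 0 < (1 / 4 : R) ^+ (edge_num H).+1 by rewrite exprn_gt0//; lra.
have [k k1 zk] := exprn_lt_eps z01 e_gt0.
have e41 : (1 / 4 : R) ^+ (edge_num H).+1 <= 1 / 4.
  by rewrite exprS ler_piMr ?exprn_ile1//; lra.
have qk : q ^+ k <= 1 / 4.
  rewrite (le_trans _ e41)// ltW// (le_lt_trans _ zk)//.
  by rewrite lerXn2r ?nnegrE// /z le_max lexx.
have bk : (b ^+ m * Rat) ^+ k < (1 / 4) ^+ edge_num H.
  apply: (@le_lt_trans _ _ (z ^+ k)).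
    rewrite lerXn2r ?nnegrE// /z ?le_max ?lexx ?orbT//.
    by rewrite mulr_ge0// exprn_ge0.
  rewrite (lt_le_trans zk)// exprS ler_piMl ?exprn_ge0//; lra.
have [_ _ /(_ W k k1 CW) CWk _] := C_adm.
pose S := sum_ge0 h k.
have mS : measurable S by exact: measurable_sum_ge0.
have aS : fine (gmu (tensor_power W k) S) <= b ^+ k.
  rewrite -lee_fin fineK ?fin_num_measure//.
  have := exponential_markov k (measurable_cst (1 : R)) mh (fun=> ler01) bE.
  apply: le_trans; rewrite le_eqVlt; apply/orP; left; apply/eqP.
  rewrite -[LHS]mul1e -integral_cst//=.
  by apply: eq_integral => x _; rewrite big1.
have DS : \int[gmu (tensor_power W k)]_(x in ~` S) deg (tensor_power W k) x
    <= (p * q) ^+ k.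
  rewrite -lee_fin EFin_Rintegral; last 2 first.
  - exact: measurableC.
  - apply: (integrableS measurableT) => //; first exact: measurableC.
    apply: (@bounded_integrable _ _ _ _ _ 1); first exact: measurable_degree.
    by move=> x; rewrite ger0_norm ?degree_ge0// degree_le1.
  apply: le_trans (exponential_markov k (@measurable_degree _ W) mlh
    (@degree_ge0 _ W) qE).
  under eq_integral do rewrite degree_tensor_power.
  apply: ge0_subset_integral => //.
  - exact: measurableC.
  - exact: measurable_sum_ge0.
  - apply/measurable_funTS/measurable_EFinP/measurable_prod => r _.
    exact: (measurableT_comp (@measurable_degree _ W) (measurable_tnth r)).
  - by move=> x _; rewrite lee_fin prodr_ge0// => r _; exact: degree_ge0.
  move=> x /= /negP; rewrite -ltNge => hx.
  by rewrite /sum_ge0/= -mulr_sumr mulNr -mulrN mulr_ge0 ?ltW// oppr_gt0.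
have pk_gt0 : 0 < p ^+ k by rewrite exprn_gt0.
have DS4 : \int[gmu (tensor_power W k)]_(x in ~` S) deg (tensor_power W k) x
    <= p ^+ k * (1 / 4).
  by rewrite (le_trans DS)// exprMn ler_pM2l.
have /(_ CWk mS) := @sidorenko_restriction (tensor_power W k) S.
rewrite edge_density_tensor_power hom_density_tensor_power.
set D := \int[_]_(x in _) _ in DS DS4 *.
have Dlt : 2 * D < p ^+ k by lra.
move=> /(_ Dlt); apply/negP; rewrite -ltNge.
apply: (@le_lt_trans _ _ (b ^+ (k * m) * hom_density H W ^+ k)).
  rewrite ler_wpM2r ?exprn_ge0 ?hom_density_ge0// exprM.
  by rewrite lerXn2r ?nnegrE ?fine_ge0 ?exprn_ge0.
apply: (@lt_le_trans _ _ ((p ^+ k * (1 / 4)) ^+ edge_num H)); last first.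
  by rewrite lerXn2r ?nnegrE//; nra.
rewrite [ltRHS]exprMn -exprM mulnC [p ^+ _]exprM -ltr_pdivrMl; last first.
  by rewrite !exprn_gt0.
rewrite (le_lt_trans _ bk)// exprMn expr_div_n -!exprM [(m * k)%N]mulnC.
by rewrite [(edge_num H * k)%N]mulnC mulrC mulrA.
Qed.

End sidorenko.

Section entropy_bound.
Context (R : realType) (C : graphon R -> Prop) (H : sgraph) (m : nat).
Hypotheses (C_adm : admissible C) (H_sid : sidorenko C H).
Hypothesis vmE : (vertex_num H + m = 2 * edge_num H)%N.
Variables (W : graphon R) (CW : C W) (p_gt0 : 0 < edge_density W).

Local Notation mu := (gmu W).
Local Notation p := (edge_density W).
Local Notation f := (@degree_density _ W).
Local Notation Rat := (hom_density H W / p ^+ edge_num H).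

(** Shifting [h] by a constant makes its [nu]-mean equal to an arbitrarily small
[d > 0], so that [sidorenko_tilt] applies; the shift multiplies the integral of
[expR h] by an exponential. *)
Lemma sidorenko_variational (h : gspace W -> R) (M : R) :
  measurable_fun setT h -> (forall x, `|h x| <= M) ->
  m%:R * (\int[mu]_x (f x * h x) - ln (\int[mu]_x expR (h x))) <= ln Rat.
Proof.
move=> mh hM; set I := \int[mu]_x _; set Z := \int[mu]_x _.
have mf := @measurable_degree_density _ W.
have fi := integrable_degree_density p_gt0.
have fb := degree_density_bound p_gt0.
have fhi : mu.-integrable setT (EFin \o (fun x => f x * h x)).
  apply: (@bounded_integrable _ _ _ _ _ (p^-1 * M)) => [|x].
    exact: measurable_funM.
  have /andP[f0 fp] := fb x.
  by rewrite normrM (ger0_norm f0) ler_pM.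
have ei : mu.-integrable setT (EFin \o (fun x => expR (h x))).
  apply: (@bounded_integrable _ _ _ _ _ (expR M)) => [|x].
    exact: measurableT_comp.
  by rewrite ger0_norm ?expR_ge0// ler_expR (le_trans (ler_norm _)).
have Z_gt0 : 0 < Z.
  apply: (@lt_le_trans _ _ (expR (- M))); first exact: expR_gt0.
  rewrite -[leLHS](Rintegral_cst1 mu); apply: le_Rintegral => //.
    exact: finite_measure_integrable_cst.
  by move=> x _; rewrite ler_expR; have := hM x; rewrite ler_norml => /andP[].
have step d : 0 < d -> m%:R * (I - ln Z) <= ln Rat + m%:R * d.
  move=> d_gt0; pose c := d - I.
  have := @sidorenko_tilt _ C H m C_adm H_sid vmE W CW p_gt0
    (fun x => c + h x) (`|c| + M).
  have -> : \int[mu]_x expR (c + h x) = expR c * Z.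
    under eq_Rintegral do rewrite expRD.
    by rewrite RintegralZl.
  have -> : \int[mu]_x (f x * (c + h x)) = d.
    under eq_Rintegral do rewrite mulrDr [X in X + _]mulrC.
    rewrite RintegralD//; last exact: (integrableZl measurableT c fi).
    by rewrite RintegralZl// integral_degree_density// mulr1 -/I /c subrK.
  move=> /(_ _ _ d_gt0) tilt.
  have {}tilt : 1 <= (expR c * Z) ^+ m * Rat.
    apply: tilt; first exact: measurable_funD.
    by move=> x; rewrite (le_trans (ler_normD _ _))// lerD2l.
  have eZ_gt0 : 0 < (expR c * Z) ^+ m.
    by rewrite exprn_gt0// mulr_gt0// expR_gt0.
  have Rat_gt0 : 0 < Rat by rewrite -(pmulr_rgt0 _ eZ_gt0) (lt_le_trans _ tilt).
  have := ln_ge0 tilt.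
  rewrite lnM ?posrE// lnXn ?mulr_gt0 ?expR_gt0// lnM ?posrE ?expR_gt0//.
  by rewrite expRK -mulr_natl /c; lra.
apply/ler_addgt0Pr => e e_gt0.
have m1_gt0 : 0 < m.+1%:R :> R by rewrite ltr0n.
rewrite (le_trans (step (e / m.+1%:R) _)) ?divr_gt0//.
by rewrite lerD2l mulrCA ler_piMr ?(ltW e_gt0)// ler_pdivrMr// mul1r ler_nat.
Qed.

(** The variational inequality for [h = ln (f + d)], which is bounded even where
[f] vanishes and dominates [ln f]. *)
Lemma entropy_le : m%:R * \int[mu]_x (f x * ln (f x)) <= ln Rat.
Proof.
have mf := @measurable_degree_density _ W.
have fi := integrable_degree_density p_gt0.
have fb := degree_density_bound p_gt0.
apply/ler_addgt0Pr => e e_gt0.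
have m1_gt0 : 0 < m.+1%:R :> R by rewrite ltr0n.
(* The loss is [m * d], and [m.+1] avoids a division by 0. *)
pose d := e / m.+1%:R; have d_gt0 : 0 < d by rewrite divr_gt0.
have fd_gt0 x : 0 < f x + d by have /andP[f0 _] := fb x; lra.
pose h x := ln (f x + d); pose M := `|ln d| + `|ln (p^-1 + d)|.
have mh : measurable_fun setT h.
  by apply: (measurableT_comp (@measurable_ln R)); exact: measurable_funD.
have hM x : `|h x| <= M.
  have /andP[f0 fp] := fb x.
  have h1 : ln d <= h x by rewrite ler_ln ?posrE// lerDr.
  have h2 : h x <= ln (p^-1 + d).
    by rewrite ler_ln ?posrE ?lerD2r// addr_gt0// invr_gt0.
  have := ler_norm (- ln d); have := ler_norm (ln (p^-1 + d)).
  rewrite normrN /M ler_norml.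
  have := normr_ge0 (ln d); have := normr_ge0 (ln (p^-1 + d)); lra.
have Zd : ln (\int[mu]_x expR (h x)) <= d.
  have -> : \int[mu]_x expR (h x) = 1 + d.
    rewrite -[in RHS](integral_degree_density p_gt0).
    rewrite -[in RHS](Rintegral_cst1 mu d) -RintegralD//.
      by apply: eq_Rintegral => x _; rewrite lnK// posrE.
    exact: finite_measure_integrable_cst.
  by apply: le_ln1Dx; lra.
have fhle : \int[mu]_x (f x * ln (f x)) <= \int[mu]_x (f x * h x).
  apply: le_Rintegral => //.
  - exact: integrable_xlnx mf fb.
  - apply: (@bounded_integrable _ _ _ _ _ (p^-1 * M)) => [|x].
      exact: measurable_funM.
    have /andP[f0 fp] := fb x.
    by rewrite normrM (ger0_norm f0) ler_pM.
  - move=> x _; have /andP[f0 _] := fb x.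
    move: f0; rewrite le_eqVlt => /predU1P[<-|f_gt0]; first by rewrite !mul0r.
    by rewrite ler_pM2l// ler_ln ?posrE// lerDl ltW.
have := sidorenko_variational mh hM.
have : m%:R * (\int[mu]_x (f x * ln (f x)) - d) <=
    m%:R * (\int[mu]_x (f x * h x) - ln (\int[mu]_x expR (h x))).
  by rewrite ler_wpM2l//; lra.
have : m%:R * d <= e.
  by rewrite mulrCA ler_piMr ?(ltW e_gt0)// ler_pdivrMr// mul1r ler_nat.
rewrite mulrBr; lra.
Qed.

End entropy_bound.

(** * The relative entropy and cut integrals *)

Section relative_entropy_density.
Context d (T : measurableType d) (R : realType) (nu P : probability T R).
Variables (f : T -> R) (K : R).
Hypotheses (mf : measurable_fun setT f) (f0K : forall x, 0 <= f x <= K).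
Hypothesis nuE : forall A, measurable A ->
  nu A = (\int[P]_(x in A) (f x)%:E)%E.

(** The Radon-Nikodym derivative agrees with [f] almost everywhere.
Integrability of its logarithm for [nu] amounts to that of [f ln f] for [P], and
[f ln f] is bounded because [f] is. *)
Lemma relative_entropy_density :
  relative_entropy nu P = (\int[P]_x (f x * ln (f x)))%:E.
Proof.
have numu : nu `<< P.
  apply/null_content_dominatesP => A mA PA0.
  rewrite nuE// null_set_integral//; apply: measurable_funTS.
  exact/measurable_EFinP.
have fi : P.-integrable setT (EFin \o f).
  apply: (@bounded_integrable _ _ _ _ _ K) => // x.
  by have /andP[f0 fK] := f0K x; rewrite ger0_norm.
pose r := Radon_Nikodym (charge_of_finite_measure nu) P.
have mr : measurable_fun setT r.
  by apply: measurable_int; exact: Radon_Nikodym_integrable.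
have rf : ae_eq P setT (EFin \o f) r.
  apply: integral_ae_eq => // E _ mE.
  by rewrite -Radon_Nikodym_integral// -nuE.
pose lr x : \bar R := (ln (fine (r x)))%:E.
have mlr : measurable_fun setT lr.
  apply/measurable_EFinP; apply: measurableT_comp; first exact: measurable_ln.
  exact: (measurableT_comp (fine_measurable measurableT) mr).
have flnf := integrable_xlnx P mf f0K.
have mflnf : measurable_fun setT (EFin \o (fun x => f x * ln (f x))).
  exact: measurable_int flnf.
have lri : nu.-integrable setT lr.
  apply/integrableP; split => //.
  rewrite -(Radon_Nikodym_SigmaFinite.change_of_variables numu)//; last first.
    exact: measurableT_comp.
  have -> : (\int[P]_x (`|lr x| * Radon_Nikodym_SigmaFinite.f nu P x) =
      \int[P]_x `|(f x * ln (f x))%:E|)%E.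
    apply: ae_eq_integral => //.
    - apply: emeasurable_funM; first exact: measurableT_comp.
      exact: measurable_int (Radon_Nikodym_SigmaFinite.f_integrable _).
    - exact: measurableT_comp.
    have := ae_eq_Radon_Nikodym_SigmaFinite numu measurableT.
    apply: filterS2 rf => x fr rS xT; rewrite rS// -/r -fr// /lr -fr//=.
    have /andP[f0 _] := f0K x.
    by rewrite normrM (ger0_norm f0) mulrC.
  by have /integrableP[] := flnf.
rewrite /relative_entropy -(Radon_Nikodym_change_of_variables numu)//.
rewrite EFin_Rintegral//; apply: ae_eq_integral => //.
- by apply: emeasurable_funM.
- apply: filterS rf => x fr xT; rewrite -/r /lr -fr//=.
  by rewrite -EFinM mulrC.
Qed.

End relative_entropy_density.

Section cut.
Context (R : realType) (W : graphon R).

Lemma integral_cylinder (A : set (gspace W)) : measurable A ->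
  \int[(gmu W \x gmu W)%E]_(z in A `*` setT) W z.1 z.2 =
  \int[gmu W]_(x in A) degree x.
Proof.
move=> mA; rewrite /Rintegral; congr fine.
pose g (z : gspace W * gspace W) := (\1_A z.1 * W z.1 z.2)%:E.
rewrite integral_mkcond [RHS]integral_mkcond.
transitivity (\int[gmu W \x gmu W]_z g z)%E.
  apply: eq_integral => -[x y] _; rewrite epatch_indic/= -EFinM mulrC.
  by rewrite /g/= !indicE in_setX in_setT andbT.
rewrite (fubini_tonelli1 g).
- apply: eq_integral => x _; rewrite epatch_indic/= muleC EFin_degree.
  rewrite -ge0_integralZl//.
  - by apply/measurable_EFinP; exact: measurable_gker_section.
  - by move=> y _; rewrite lee_fin gker_ge0.
- apply/measurable_EFinP/measurable_funM; last exact: gker_measurable.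
  exact: (measurableT_comp (measurable_indic mA) measurable_fst).
- by move=> z; rewrite lee_fin mulr_ge0// gker_ge0.
Qed.

End cut.

Theorem theorem6p1 (R : realType) (C : graphon R -> Prop) (H : sgraph)
    (C_adm : admissible C) (H_sid : sidorenko C H)
    (s : R) (sE : s = (2 * edge_num H)%:R - (vertex_num H)%:R) (s_gt0 : 0 < s)
    (W : graphon R) (CW : C W) (p_gt0 : 0 < edge_density W) :
  let p := edge_density W in
  let Rat := hom_density H W / p ^+ edge_num H in
  let mu := gmu W in
  let nu := degree_distribution p_gt0 in
  [/\ (relative_entropy nu mu <= (ln Rat / s)%:E)%E,
      tv_distance nu mu <= Num.sqrt (ln Rat / (2 * s)) &
      forall A : set (gspace W), measurable A ->
        `|\int[(mu \x mu)%E]_(z in A `*` setT) W z.1 z.2 - p * fine (mu A)|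
          <= p * Num.sqrt (ln Rat / (2 * s))].
Proof.
move=> p Rat mu nu.
pose f := @degree_density _ W.
have mf : measurable_fun setT f by exact: measurable_degree_density.
have fb : forall x, 0 <= f x <= p^-1 by exact: degree_density_bound.
have fi : mu.-integrable setT (EFin \o f) by exact: integrable_degree_density.
have vme : (vertex_num H + (2 * edge_num H - vertex_num H) = 2 * edge_num H)%N.
  by rewrite subnKC// -(ler_nat R) -subr_ge0 -sE ltW.
have sm : (2 * edge_num H - vertex_num H)%:R = s.
  by rewrite sE -[in RHS]vme natrD addrAC subrr add0r.
have := entropy_le C_adm H_sid vme CW p_gt0; rewrite sm -/f -/p -/Rat -/mu.
set D := \int[mu]_x _ => DRat.
have DRs : D <= ln Rat / s by rewrite ler_pdivlMr// mulrC.
have nuE A : measurable A -> fine (nu A) = \int[mu]_(x in A) f x by [].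
have tv A : measurable A ->
    `|fine (nu A) - fine (mu A)| <= Num.sqrt (ln Rat / (2 * s)).
  move=> mA; rewrite nuE// -sqrtr_sqr ler_wsqrtr//.
  have := pinsker mf fb (integral_degree_density p_gt0) mA; rewrite -/D -/mu.
  have -> : ln Rat / (2 * s) = (ln Rat / s) / 2 by field; exact: lt0r_neq0.
  lra.
split.
- rewrite (@relative_entropy_density _ _ _ nu mu f p^-1)//.
- apply: ge_sup => [|_ [A mA <-]]; last exact: tv.
  by exists `|fine (nu set0) - fine (mu set0)|; exists set0.
- move=> A mA.
  have -> : \int[(mu \x mu)%E]_(z in A `*` setT) W z.1 z.2 = p * fine (nu A).
    rewrite integral_cylinder// nuE// -RintegralZl//;
      last exact: integrableS fi.
    apply: eq_Rintegral => x _.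
    by rewrite /f /degree_density mulrC divfK// gt_eqF.
  by rewrite -mulrBr normrM (gtr0_norm p_gt0) ler_pM2l// tv.
Qed.
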